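(* Let $\mathbf X,\mathbf X_1,\dots,\mathbf X_n$ be i.i.d. centered random vectors in $\mathbb R^d$ with invertible covariance matrix $\Sigma=\mathbb E\,\mathbf X\mathbf X^\top$, let $\widehat\Sigma=\frac1n\sum_{i=1}^n\mathbf X_i\mathbf X_i^\top$ and $\boldsymbol\xi=\Sigma^{-1/2}\mathbf X$. Suppose that there exists $\alpha>0$ such that $$\mathbb E\left(\boldsymbol\xi^\top V\boldsymbol\xi-\mathbb E\,\boldsymbol\xi^\top V\boldsymbol\xi\right)^4\le\alpha^2\|V\|_{\mathrm F}^4\quad\text{for all }V\in\mathbb R^{d\times d},$$ and that $n$ satisfies $$5\,\mathtt r(\Sigma^2)\left(3\,\mathtt r(\Sigma)^2+\frac{2\,\mathtt r(\Sigma^2)\,\mathtt r(\Sigma)^2}{\alpha}\right)\le n\quad\text{and}\quad 96\left(1+\sqrt\alpha\right)^2\left(3\,\mathtt r(\Sigma)^2+\frac{2\,\mathtt r(\Sigma^2)\,\mathtt r(\Sigma)^2}{\alpha}\right)\le\alpha n.$$ Then, for any $\delta\in(0,1)$, with probability at least $1-\delta$, $$\|\widehat\Sigma-\Sigma\|_{\mathrm F}^2-\mathbb E\|\widehat\Sigma-\Sigma\|_{\mathrm F}^2>-\frac{4\|\Sigma\|^2}{n}\max\left\{2\alpha\log(5/\delta),\;\sqrt{2\,\mathfrak R(\Sigma)\log(5/\delta)}\right\},$$ where $$\mathfrak R(\Sigma)=\alpha\,\mathtt r(\Sigma^2)^2+\alpha^2\,\mathtt r(\Sigma^4)+\frac{5\alpha^2\,\mathtt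 r(\Sigma)^2}{2n}\left(3\,\mathtt r(\Sigma)^2+\frac{2\,\mathtt r(\Sigma^2)\,\mathtt r(\Sigma)^2}{\alpha}\right).$$
   Context: $\|\cdot\|_{\mathrm F}$ and $\|\cdot\|$ are the Frobenius and operator norms. For a nonzero symmetric positive semidefinite matrix $A$, $\mathtt r(A)=\mathrm{Tr}(A)/\|A\|$ (effective rank); so $\mathtt r(\Sigma^2)=\mathrm{Tr}(\Sigma^2)/\|\Sigma\|^2$ and $\mathtt r(\Sigma^4)=\mathrm{Tr}(\Sigma^4)/\|\Sigma\|^4$. *)

(* Defs.v *)
From HB Require Import structures.
From mathcomp Require Import all_boot all_order all_algebra.
From mathcomp Require Import all_classical all_reals all_analysis.

Set Implicit Arguments.
Unset Strict Implicit.
Unset Printing Implicit Defensive.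

Import Order.TTheory GRing.Theory Num.Theory.
Import numFieldNormedType.Exports.

Local Open Scope classical_set_scope.
Local Open Scope ring_scope.

Section Matrices.
Context {R : realType}.

(* On column vectors this is the Euclidean norm. *)
Definition frob {m n : nat} (A : 'M[R]_(m, n)) : R :=
  Num.sqrt (\sum_(i < m) \sum_(j < n) A i j ^+ 2).

Definition opnorm {m n : nat} (A : 'M[R]_(m, n)) : R :=
  sup [set frob (A *m x) | x in [set x : 'cV[R]_n | frob x <= 1]].

Definition quadform {n : nat} (V : 'M[R]_n) (x : 'cV[R]_n) : R :=
  (x^T *m V *m x) 0 0.

Definition psdmx {n : nat} (A : 'M[R]_n) : Prop :=
  A^T = A /\ forall x : 'cV[R]_n, 0 <= quadform A x.

(* The positive semidefinite square root exists and is unique when [A] is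
   positive semidefinite; [xget] returns the default value 0 otherwise. *)
Definition sqrtmx {n : nat} (A : 'M[R]_n) : 'M[R]_n :=
  xget 0 [set S | psdmx S /\ S *m S = A].

Definition effrank {n : nat} (A : 'M[R]_n) : R := \tr A / opnorm A.

End Matrices.

(* Random vectors take values in [d.-tuple R], which carries the product
   sigma-algebra, i.e. the Borel sigma-algebra of R^d. *)
Definition colv {R : realType} {d : nat} (x : d.-tuple R) : 'cV[R]_d :=
  \col_i tnth x i.

Section Probability.
Context {dT : measure_display} {T : measurableType dT} {R : realType}
        (P : probability T R).

Definition mutually_independent {dU : measure_display} {U : measurableType dU}
    {I : finType} (X : I -> {RV P >-> U}) : Prop :=
  forall (J : {set I}) (B : I -> set U), (forall i, measurable (B i)) ->
    P (\bigcap_(i in [set` J]) (X i @^-1` B i)) =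
    (\prod_(i in J) P (X i @^-1` B i))%E.

Definition identically_distributed {dU : measure_display}
    {U : measurableType dU} {I : finType} (X : I -> {RV P >-> U}) : Prop :=
  forall (i j : I) (B : set U), measurable B ->
    distribution P (X i) B = distribution P (X j) B.

Definition iid {dU : measure_display} {U : measurableType dU}
    {I : finType} (X : I -> {RV P >-> U}) : Prop :=
  mutually_independent X /\ identically_distributed X.

(* [fine] sends infinite values to 0, so these are the usual expectations only
   for integrable arguments. *)
Definition expect (Y : T -> R) : R := fine 'E_P[Y].

Definition expect_mx {m n : nat} (M : T -> 'M[R]_(m, n)) : 'M[R]_(m, n) :=
  \matrix_(i, j) expect (fun w => M w i j).

Definition square_integrable {d : nat} (X : {RV P >-> d.-tuple R}) : Prop :=
  forall i : 'I_d, (fun w => tnth (X w) i) \in Lfun P 2%:E.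

Definition centered {d : nat} (X : {RV P >-> d.-tuple R}) : Prop :=
  expect_mx (fun w => colv (X w)) = 0.

(* The covariance matrix of a centered random vector. *)
Definition covmx {d : nat} (X : {RV P >-> d.-tuple R}) : 'M[R]_d :=
  expect_mx (fun w => colv (X w) *m (colv (X w))^T).

Definition sample_covmx {n d : nat} (X : 'I_n -> {RV P >-> d.-tuple R})
    (w : T) : 'M[R]_d :=
  n%:R^-1 *: \sum_(i < n) colv (X i w) *m (colv (X i w))^T.

Definition standardized {d : nat} (X : {RV P >-> d.-tuple R})
    (w : T) : 'cV[R]_d :=
  invmx (sqrtmx (covmx X)) *m colv (X w).

End Probability.

(* Main.v *)
Require Import Defs.
From HB Require Import structures.
From mathcomp Require Import all_boot all_order all_algebra.
From mathcomp Require Import all_classical all_reals all_analysis.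
From mathcomp Require Import measurable_realfun sesquilinear spectral mxpoly ring lra.
From mathcomp Require complex.

Set Implicit Arguments.
Unset Strict Implicit.
Unset Printing Implicit Defensive.

Import Order.TTheory GRing.Theory Num.Theory.
Import numFieldNormedType.Exports.

Local Open Scope classical_set_scope.
Local Open Scope ring_scope.

(** Put [A_i = X_i X_i^T - Sigma], [M = n^-1 (A_1 + ... + A_n)], and let [G] be a
    standard Gaussian matrix.  The Laplace transform of [|M|_F^2] linearizes as
    [E exp (- lambda |M|^2) = E_G E cos (sqrt (2 lambda) <G, M>)], and for fixed
    [G] the inner expectation is at most [|phi|^n], where [phi] is the
    characteristic function of [<V, A>] at [V = sqrt (2 lambda) G / n].
    Symmetrization and [cos x <= 1 - x^2/2 + x^4/24] give
    [|phi|^2 <= exp (- Var <V, A> + a^2 / 3)] with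
    [a = alpha |Sigma^(1/2) V Sigma^(1/2)|^2], a fourth-moment bound without any
    restriction on [V]; when [|Sigma^(1/2) G Sigma^(1/2)|^2 > 3 (tr Sigma)^2] one
    uses [|phi| <= 1] instead, and this event is exponentially unlikely.  What
    remains are Gaussian integrals of exponentials of quadratic forms, computed
    one coordinate at a time by completing the square: with [Q = Cov A],
    [E exp (- s G^T Q G) <= exp (- s tr Q + s^2 |Q|_F^2)].  Since
    [E |M|^2 = tr Q / n], the term [tr Q] cancels, [|Q|_F^2] is bounded by
    [alpha (tr Sigma^2)^2 + alpha^2 tr Sigma^4], and Chernoff's bound concludes. *)

(** * Gaussian integrals *)

(** The lower tail needs only four moments because exp (- lambda |M|^2) is bounded, so no
    exponential moment of X is involved. The obstacle is that |M|^2 contains the cross products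
    <A_i, A_j> and does not factor over the sample; the Gaussian average of cosines restores a
    product. Everything stays real: characteristic functions are pairs (E cos, E sin), and 1 + cos
    replaces cos over the product space, so that Tonelli's theorem suffices.

    The origin of the constants: let kappa = |Sigma|^2, K = Sigma (x) Sigma and tau = tr K = (tr
    Sigma)^2. On the atypical event, 1 is bounded by exp ((<G, K G> - 3 tau) / (4 kappa)). The
    Gaussian integral of exp (<G, K G> / (4 kappa)) is at most exp (tau / (2 kappa)), so this event
    contributes at most exp (- tau / (4 kappa)). Since tr Q <= alpha tau, that is at most exp (-
    lambda tr Q / n) as soon as lambda <= n / (4 alpha kappa). This cap on lambda produces the
    linear branch 2 alpha log (5 / delta) of the maximum. *)

Section Weight.
Local Open Scope ereal_scope.
Context d1 d2 (T : measurableType d1) (U : measurableType d2) (R : realType).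
Import HBNNSimple.

(** One change-of-variables principle for two uses: with [Y] the identity and [G] a density it
    integrates against [normal_prob]; with [G] a function of other variables it expresses
    independence from [Y]. Both sides are limits along simple functions approximating [f], for which
    the claim is a sum of instances of the hypothesis on sets. *)
Lemma ge0_integral_weight (mu : {measure set T -> \bar R})
    (nu : {measure set U -> \bar R}) (Y : T -> U) (G : T -> R) :
  measurable_fun [set: T] Y -> measurable_fun [set: T] G ->
  (forall x, (0 <= G x)%R) ->
  (forall B, measurable B -> \int[mu]_x (G x * \1_B (Y x))%:E = nu B) ->
  forall f : U -> \bar R, measurable_fun [set: U] f -> (forall y, 0 <= f y) ->
  \int[mu]_x ((G x)%:E * f (Y x)) = \int[nu]_y f y.
Proof.
move=> mY mG G0 GB f mf f0.
pose h := nnsfun_approx measurableT mf.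
have mhY n : measurable_fun [set: T] (h n \o Y) by exact: measurableT_comp.
have -> : \int[nu]_y f y = limn (fun n => \int[nu]_x (EFin \o h n) x).
  rewrite -monotone_convergence//.
  - apply: eq_integral => x _; apply/esym/cvg_lim => //.
    exact: cvg_nnsfun_approx.
  - by move=> n; apply/measurable_EFinP.
  - by move=> n x _ /=; rewrite lee_fin.
  - by move=> x _ a b ab; rewrite lee_fin; exact/lefP/nd_nnsfun_approx.
have -> : \int[mu]_x ((G x)%:E * f (Y x)) =
    limn (fun n => \int[mu]_x ((G x)%:E * (h n (Y x))%:E)).
  rewrite -monotone_convergence//.
  - apply: eq_integral => x _; apply/esym/cvg_lim => //.
    by apply: cvgeZl => //; exact: cvg_nnsfun_approx.
  - by move=> n; apply: emeasurable_funM; apply/measurable_EFinP => //; exact: mhY.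
  - by move=> n x _ /=; rewrite mule_ge0 ?lee_fin.
  - move=> x _ a b ab; rewrite lee_pmul ?lee_fin//.
    exact/lefP/nd_nnsfun_approx.
congr (limn _); apply/funext => n.
have m1 r : measurable_fun [set: U] (fun x => (r * \1_(h n @^-1` [set r]) x)%:E).
  by apply/measurable_EFinP; exact: measurable_funM.
rewrite (_ : (fun x => _) = fun x =>
    \sum_(r \in range (h n)) ((G x)%:E * (r * \1_(h n @^-1` [set r]) (Y x))%:E)).
  rewrite [RHS](_ : _ = \int[nu]_x
      \sum_(r \in range (h n)) (r * \1_(h n @^-1` [set r]) x)%:E); last first.
    by apply: eq_integral => t tE; rewrite /= fimfunE -fsumEFin.
  rewrite ge0_integral_fsum//; last 2 first.
  - move=> r; apply: emeasurable_funM; first exact/measurable_EFinP.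
    exact: (measurableT_comp (m1 r)).
  - by move=> r x _; rewrite mule_ge0 ?lee_fin// -lee_fin nnfun_muleindic_ge0.
  rewrite ge0_integral_fsum//; last by move=> r x _; exact: nnfun_muleindic_ge0.
  apply: eq_fsbigr => r; rewrite inE => -[y _ <-].
  rewrite [RHS](_ : _ = (h n y)%:E * \int[nu]_x (\1_(h n @^-1` [set h n y]) x)%:E).
    rewrite integral_indic// setIT -GB//.
    rewrite -ge0_integralZl_EFin//.
    - by apply: eq_integral => x _; rewrite -!EFinM mulrCA.
    - by move=> x _; rewrite lee_fin mulr_ge0.
    - apply/measurable_EFinP; apply: measurable_funM => //.
      exact: measurableT_comp.
  rewrite -ge0_integralZl_EFin//; exact/measurable_EFinP.
apply/funext => x; rewrite -ge0_mule_fsumr; last first.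
  by move=> r; exact: nnfun_muleindic_ge0.
by rewrite fsumEFin// -(fimfunE _ (Y x)).
Qed.

End Weight.

Section Trigo.
Context {R : realType}.

Lemma ge0_of_derive (f df : R -> R) :
  (forall x : R, is_derive x 1 f (df x)) -> 0 <= f 0 ->
  (forall x, 0 <= x -> 0 <= df x) -> forall x, 0 <= x -> 0 <= f x.
Proof.
move=> fdf f0 df0 x x0.
have cf : {within `[0, x], continuous f}.
  apply: continuous_subspaceT => y.
  by apply: differentiable_continuous; apply/derivable1_diffP; exact: ex_derive.
have [c] := @MVT_segment _ f df 0 x x0 (fun y _ => fdf y) cf.
rewrite in_itv/= => /andP[c0 _] /eqP; rewrite subr_eq subr0 => /eqP ->.
by rewrite addr_ge0// mulr_ge0// df0.
Qed.

(** Integrating 1 - cos >= 0 four times from 0 gives the successive Taylor bounds [h1] to [h4];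
    evenness reduces to x >= 0. *)
Lemma cos_le_taylor4 (x : R) : cos x <= 1 - x ^+ 2 / 2 + x ^+ 4 / 24.
Proof.
wlog x0 : x / 0 <= x.
  move=> H; have [|/ltW x0] := leP 0 x; first exact: H.
  by have := H (- x); rewrite cosN oppr_ge0 sqrrN (exprM (- x) 2 2) sqrrN -exprM;
    apply.
have h1 (y : R) : 0 <= y -> 0 <= y - sin y.
  move=> y0; refine (@ge0_of_derive (fun y => y - sin y) (fun y => 1 - cos y) _ _ _
    y y0).
  - by rewrite sin0 subrr lexx.
  - by move=> z _; rewrite subr_ge0 cos_le1.
have h2 (y : R) : 0 <= y -> 0 <= 2^-1 * y ^+ 2 - 1 + cos y.
  move=> y0; refine (@ge0_of_derive (fun y => 2^-1 * y ^+ 2 - 1 + cos y) (fun y => y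
    - sin y) _ _ _ y y0); last exact: h1.
  - move=> z; apply: is_derive_eq.
    by rewrite /GRing.scale/=; field.
  - by rewrite cos0 expr0n/=; lra.
have h3 (y : R) : 0 <= y -> 0 <= 6^-1 * y ^+ 3 - y + sin y.
  move=> y0; refine (@ge0_of_derive (fun y => 6^-1 * y ^+ 3 - y + sin y)
    (fun y => 2^-1 * y ^+ 2 - 1 + cos y) _ _ _ y y0); last exact: h2.
  - move=> z; apply: is_derive_eq.
    by rewrite /GRing.scale/=; field.
  - by rewrite sin0 !expr0n/=; lra.
have h4 (y : R) : 0 <= y -> 0 <= 24^-1 * y ^+ 4 - 2^-1 * y ^+ 2 + 1 - cos y.
  move=> y0; refine (@ge0_of_derive
    (fun y => 24^-1 * y ^+ 4 - 2^-1 * y ^+ 2 + 1 - cos y)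
    (fun y => 6^-1 * y ^+ 3 - y + sin y) _ _ _ y y0); last exact: h3.
  - move=> z; apply: is_derive_eq.
    by rewrite /GRing.scale/=; field.
  - by rewrite cos0 !expr0n/=; lra.
by have := h4 _ x0; lra.
Qed.

End Trigo.

Section StandardGaussian.
Local Open Scope ereal_scope.
Context {R : realType}.
Local Notation gamma := (normal_prob (0 : R) 1).
Local Notation leb := (@lebesgue_measure R).

Lemma ge0_integral_normal_prob (f : R -> \bar R) :
  measurable_fun [set: R] f -> (forall x, 0 <= f x) ->
  \int[gamma]_x f x = \int[leb]_x ((normal_pdf 0 1 x)%:E * f x).
Proof.
move=> mf f0.
rewrite -(@ge0_integral_weight _ _ _ _ _ leb gamma id (normal_pdf 0 1))//.
- exact: measurable_normal_pdf.
- by move=> x; exact: normal_pdf_ge0.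
- move=> B mB; rewrite /normal_prob [RHS]integral_mkcond.
  apply: eq_integral => x _; rewrite patchE indicE; case: ifPn => xB.
    by rewrite mulr1.
  by rewrite mulr0.
Qed.

Lemma integral_normal_expR_quad (h b : R) : (0 < 1 + h)%R ->
  \int[gamma]_x (expR (- (h * x ^+ 2) / 2 + b * x))%:E =
  ((Num.sqrt (1 + h))^-1 * expR (b ^+ 2 / (2 * (1 + h))))%:E.
Proof.
move=> h0.
have mf : measurable_fun [set: R] (fun x : R => (expR (- (h * x ^+ 2) / 2 + b *
  x))%:E).
  apply/measurable_EFinP; apply: measurableT_comp => //.
  apply: measurable_funD; last exact: measurable_funM.
  apply: measurable_funM => //; apply: measurableT_comp => //.
  by apply: measurable_funM => //; exact: measurable_funX.
rewrite ge0_integral_normal_prob//.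
(* Completing the square: the integrand is [C] times the normal density with variance s^2 = 1 / (1 +
   h) and mean m = b / (1 + h). *)
pose s : R := (Num.sqrt (1 + h))^-1%R.
have s0 : (0 < s)%R by rewrite invr_gt0 sqrtr_gt0.
have s2 : (s ^+ 2 = (1 + h)^-1)%R by rewrite exprVn sqr_sqrtr// ltW.
pose m : R := (b / (1 + h))%R.
set C := (_ * _)%R.
have C0 : (0 <= C)%R by rewrite mulr_ge0// ?expR_ge0// invr_ge0 sqrtr_ge0.
transitivity (\int[leb]_x (C%:E * (normal_pdf m s x)%:E)).
  apply: eq_integral => x _; rewrite -!EFinM; congr EFin.
  rewrite !normal_pdfE ?oner_neq0 ?gt_eqF//.
  rewrite /normal_peak /normal_fun.
  rewrite -mulrA -expRD /C -/s mulrACA -expRD.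
  have -> : (s * (Num.sqrt (s ^+ 2 * pi *+ 2))^-1 = (Num.sqrt (1 ^+ 2 * pi *+ 2))^-1
    :> R)%R.
    rewrite -!mulrnAr sqrtrM ?sqr_ge0//
      sqrtr_sqr (gtr0_norm s0) invfM mulrA divff ?gt_eqF//.
    by rewrite mul1r expr1n mul1r.
  congr (_ * expR _)%R.
  rewrite s2 /m expr1n.
  by field; rewrite gt_eqF.
rewrite ge0_integralZl_EFin//.
- by rewrite integral_normal_pdf mule1.
- by move=> x _; rewrite lee_fin normal_pdf_ge0.
- by apply/measurable_EFinP; exact: measurable_normal_pdf.
Qed.

End StandardGaussian.

Section GaussianCharacteristicFunction.
Context {R : realType}.
Variable theta : R.
Local Notation leb := (@lebesgue_measure R).

(** [phi] and [psi] are the real and imaginary parts of exp (- (x - i u)^2 / 2 + i theta), and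
    [dphi] is the derivative they share through the Cauchy-Riemann equations. The section is a
    contour shift carried out with real functions. *)
Let phi (u x : R) : R := cos (u * x + theta) * expR (2^-1 * (u ^+ 2 - x ^+ 2)).
Let dphi (u x : R) : R := (u * cos (u * x + theta) - x * sin (u * x + theta)) *
  expR (2^-1 * (u ^+ 2 - x ^+ 2)).
Let psi (u x : R) : R := sin (u * x + theta) * expR (2^-1 * (u ^+ 2 - x ^+ 2)).

Let is_derive_phi (u x : R) : is_derive u 1 (phi ^~ x) (dphi u x).
Proof.
rewrite /phi /dphi; apply: is_derive_eq.
by rewrite /GRing.scale/=; field.
Qed.

(* The same function is a derivative in [x] as well, which is why the integral
   over [x] of [phi u] does not depend on [u]. *)
Let is_derive_psi (u x : R) : is_derive x 1 (psi u) (dphi u x).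
Proof.
rewrite /psi /dphi; apply: is_derive_eq.
by rewrite /GRing.scale/=; field.
Qed.

Let continuous_is_derive (f df : R -> R) :
  (forall x : R, is_derive x 1 f (df x)) -> continuous f.
Proof.
by move=> fdf x; apply: differentiable_continuous; apply/derivable1_diffP;
  exact: ex_derive.
Qed.

Let continuous_phi u : continuous (phi u).
Proof.
apply: (@continuous_is_derive _ (fun x => (- u * sin (u * x + theta) - x * cos (u *
  x + theta)) *
   expR (2^-1 * (u ^+ 2 - x ^+ 2)))) => x.
rewrite /phi; apply: is_derive_eq.
by rewrite /GRing.scale/=; field.
Qed.

Let continuous_dphi u : continuous (dphi u).
Proof.
apply: (@continuous_is_derive _ (fun x => (- u ^+ 2 * sin (u * x + theta) - sin (u *
  x + theta) - u * x * cos (u * x + theta)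
    - x * (u * cos (u * x + theta) - x * sin (u * x + theta))) *
   expR (2^-1 * (u ^+ 2 - x ^+ 2)))) => x.
rewrite /dphi; apply: is_derive_eq.
by rewrite /GRing.scale/=; field.
Qed.

(** Truncation to a compact interval allows a constant as dominating function for differentiation
    under the integral, and reduces the derivative in u to boundary values of [psi], which vanish as
    N grows. *)
Let J (N : nat) (u : R) : R := \int[leb]_(x in `[- N%:R, N%:R]) phi u x.

Let integrable_cont (f : R -> R) (a b : R) : continuous f ->
  leb.-integrable `[a, b] (EFin \o f).
Proof.
move=> cf; apply: continuous_compact_integrable; first exact: segment_compact.
exact: continuous_subspaceT.
Qed.

Let integral_dphi (N : nat) u : \int[leb]_(x in `[- N%:R, N%:R]) dphi u x =
  psi u N%:R - psi u (- N%:R).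
Proof.
have [->|N0] := eqVneq N 0.
  by rewrite oppr0 subrr set_itv1 Rintegral_set1.
rewrite /Rintegral (@continuous_FTC2 _ (dphi u) (psi u))//.
- by rewrite gtrN// ltr0n lt0n.
- by apply: continuous_subspaceT; exact: continuous_dphi.
- have cpsi := continuous_is_derive (is_derive_psi u).
  split.
  + by move=> x _; exact: ex_derive.
  + by apply: cvg_at_right_filter; exact: cpsi.
  + by apply: cvg_at_left_filter; exact: cpsi.
- by move=> x _; rewrite derive1E; exact: derive_val.
Qed.

Let dphi_bound (N : nat) (a u x : R) :
  u \in `]a - 1, a + 1[ -> x \in `[- N%:R, N%:R] ->
  `|dphi u x| <= (`|a| + 1 + N%:R) * expR (2^-1 * (`|a| + 1) ^+ 2).
Proof.
rewrite !in_itv/= => /andP[u1 u2] xN.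
have ua : `|u| <= `|a| + 1.
  rewrite -[u](subrK a) addrC (le_trans (ler_normD _ _))// lerD2l ler_norml.
  by rewrite !(lerBrDl, lerBlDl); apply/andP; split; apply/ltW; lra.
have xN' : `|x| <= N%:R by rewrite ler_norml.
rewrite normrM (ger0_norm (expR_ge0 _)) ler_pM ?expR_ge0//.
  rewrite (le_trans (ler_normB _ _))// !normrM lerD//.
    by rewrite (le_trans _ ua)// ler_piMr// cos_max.
  by rewrite (le_trans _ xN')// ler_piMr// sin_max.
rewrite ler_expR ler_pM2l// (@le_trans _ _ (u ^+ 2))//;
  first by rewrite gerBl sqr_ge0.
by rewrite -(real_normK (num_real u)) lerXn2r// nnegrE addr_ge0.
Qed.

Let is_derive_J (N : nat) (u : R) : is_derive u 1 (J N) (psi u N%:R - psi u (-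
  N%:R)).
Proof.
have d1 v x : partial1of2 phi v x = dphi v x.
  by rewrite partial1of2E; exact: derive_val.
pose I : set R := `]u - 1, u + 1[%classic.
pose D : set R := `[- N%:R, N%:R]%classic.
have uI : I u by rewrite /I/= in_itv/= ltrBlDr ltrDl ltr01.
have H1 x : I x -> leb.-integrable `[- N%:R, N%:R] (EFin \o phi x).
  by move=> _; exact: integrable_cont.
have H2 x y : I x -> D y -> derivable (phi^~ y) x 1.
  by move=> _ _; exact: ex_derive.
pose M := (`|u| + 1 + N%:R) * expR (2^-1 * (`|u| + 1) ^+ 2).
have H3 (y : R) : 0 <= (cst M y) by rewrite /M/= mulr_ge0 ?expR_ge0// !addr_ge0.
have H4 : leb.-integrable `[- N%:R, N%:R] (EFin \o cst M).
  by apply: integrable_cont; exact: cst_continuous.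
have H5 x y : I x -> D y -> `|partial1of2 phi x y| <= cst M y.
  by move=> xI yI; rewrite d1; exact: dphi_bound.
have mI : measurable (`[- N%:R,
  N%:R]%classic : set (measurableTypeR R)) by exact: measurable_itv.
apply: DeriveDef.
  exact: (derivable_under_integral mI uI H1 H2 H3 H4 H5).
rewrite -derive1E (differentiation_under_integral mI uI H1 H2 H3 H4 H5).
rewrite -integral_dphi; apply: eq_Rintegral => x _; exact: d1.
Qed.

Let J_dist (N : nat) (u : R) :
  `|J N u - J N 0| <= `|u| * 2 * expR (2^-1 * (u ^+ 2 - N%:R ^+ 2)).
Proof.
have cJ : continuous (J N) by exact: continuous_is_derive (is_derive_J N).
pose g c := psi c N%:R - psi c (- N%:R).
have gb c : `|c| <= `|u| -> `|g c| <= 2 * expR (2^-1 * (u ^+ 2 - N%:R ^+ 2)).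
  move=> cu; rewrite /g /psi sqrrN -mulrBl normrM (ger0_norm (expR_ge0 _)).
  rewrite ler_pM ?expR_ge0//.
    by rewrite (le_trans (ler_normB _ _))// -[leRHS]/(1 + 1) lerD// sin_max.
  rewrite ler_expR ler_pM2l// lerD2r -(real_normK (num_real u)).
  by rewrite -(real_normK (num_real c)) lerXn2r// nnegrE.
have [u0|u0] := leP 0 u.
  have [c] := @MVT_segment _ (J N) g 0 u u0 (fun y _ => is_derive_J N y)
    (continuous_subspaceT cJ).
  rewrite in_itv/= => /andP[c0 cu] ->.
  by rewrite subr0 normrM mulrC -mulrA ler_wpM2l// gb// !ger0_norm.
have [c] := @MVT_segment _ (J N) g u 0 (ltW u0) (fun y _ => is_derive_J N y)
    (continuous_subspaceT cJ).
rewrite in_itv/= => /andP[uc c0] Jc.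
rewrite distrC Jc sub0r normrM normrN mulrC -mulrA ler_wpM2l// gb//.
by rewrite !ler0_norm ?lerN2// ltW.
Qed.

Let gauss (x : R) := expR (2^-1 * (0 ^+ 2 - x ^+ 2)).

Let gaussE x : gauss x = (normal_peak 1)^-1 * normal_pdf 0 1 x.
Proof.
rewrite normal_pdfE ?oner_neq0// mulrA mulVf ?gt_eqF ?normal_peak_gt0 ?oner_neq0//
  mul1r.
by rewrite /normal_fun /gauss; congr expR; field.
Qed.

Let integrable_phi u : leb.-integrable setT (EFin \o phi u).
Proof.
pose K := expR (2^-1 * u ^+ 2) / normal_peak (1 : R).
apply: (@le_integrable _ _ _ leb _ _ _ (fun x => K%:E * (normal_pdf 0 1 x)%:E)%E).
- exact: measurableT.
- by apply/measurable_EFinP; apply: continuous_measurable_fun;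
    exact: continuous_phi.
- move=> x _; rewrite /= lee_fin [leRHS]ger0_norm; last first.
    by rewrite mulr_ge0 ?normal_pdf_ge0// mulr_ge0 ?expR_ge0//
      invr_ge0 normal_peak_ge0.
  rewrite /K -mulrA -gaussE /phi normrM (ger0_norm (expR_ge0 _)).
  rewrite (_ : expR (2^-1 * (u ^+ 2 - x ^+ 2)) = expR (2^-1 * u ^+ 2) * gauss x).
    by rewrite ler_piMl ?mulr_ge0 ?expR_ge0// cos_max.
  by rewrite /gauss -expRD; congr expR; field.
- apply: integrableZl; first exact: measurableT.
  exact: integrable_normal_pdf.
Qed.

Let J_cvg u : J N u @[N --> \oo] --> \int[leb]_x phi u x.
Proof.
pose f_ (n : nat) x := ((EFin \o phi u) \_ `[- n%:R, n%:R]) x.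
have mphi : measurable_fun [set: measurableTypeR R] (EFin \o phi u).
  by apply/measurable_EFinP; apply: continuous_measurable_fun;
    exact: continuous_phi.
have [||||_ _] := @dominated_convergence _ _ R leb setT measurableT f_
  (EFin \o phi u) (abse \o (EFin \o phi u)) _ mphi.
- move=> n; apply/(measurable_restrictT _ (measurable_itv _)).
  exact: measurable_funTS.
- apply: aeW => x _; apply: cvg_near_cst; near=> n.
  rewrite /f_ patchE mem_set//= in_itv/= -ler_norml.
  by near: n; exact: nbhs_infty_ger.
- exact: integrable_abse (integrable_phi u).
- apply: aeW => x n _; rewrite /f_ patchE; case: ifPn => //= _.
  by rewrite normr0 lee_fin.
- move=> H; rewrite /J /Rintegral.
  apply: fine_cvg; rewrite fineK; last first.
    exact: integrable_fin_num (integrable_phi u).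
  by under eq_fun do rewrite integral_mkcond.
Unshelve. all: by end_near. Qed.

Let integral_phi_const u : \int[leb]_x phi u x = \int[leb]_x phi 0 x.
Proof.
have H : (fun N => J N u - J N 0) @ \oo --> \int[leb]_x phi u x - \int[leb]_x phi 0
  x.
  by apply: cvgB; exact: J_cvg.
have H0 : (fun N => J N u - J N 0) @ \oo --> (0 : R).
  (* A crude rate suffices: exp (N^2 / 2) >= 1 + N^2 / 2 >= (N + 1) / 2, the last step by (N -
     1/2)^2 >= 0. *)
  have key (N : nat) : expR (- (2^-1 * N%:R ^+ 2)) <= 2 * harmonic N :> R.
    rewrite expRN -[2 * _]invrK lef_pV2 ?posrE ?expR_gt0 ?invr_gt0 ?mulr_gt0
      ?invr_gt0//.
    rewrite invfM invrK; apply: le_trans (expR_ge1Dx _).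
    have : 0 <= (N%:R - 2^-1) ^+ 2 :> R by exact: sqr_ge0.
    by rewrite /harmonic/= -[N.+1%:R]natr1; move: (N%:R : R) => x; nra.
  pose C := `|u| * 2 * expR (2^-1 * u ^+ 2) * 2.
  have hC : C * harmonic N @[N --> \oo] --> (0 : R).
    rewrite -[X in _ --> X](mulr0 C); apply: (@cvgM _ _ \oo _ (fun=> C) harmonic);
      [exact: cvg_cst|exact: cvg_harmonic].
  apply: (@squeeze_cvgr _ _ _ _ (fun N => - (C * harmonic N)) (fun N => C * harmonic
    N)) => //.
    apply: nearW => N; rewrite -ler_norml (le_trans (J_dist N u))//.
    rewrite mulrBr expRD /C -!mulrA ler_wpM2l// ler_wpM2l// ler_wpM2l ?expR_ge0//
      key.
  by rewrite -oppr0; apply: cvgN.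
by apply/eqP; rewrite -subr_eq0; apply/eqP; exact: (cvg_unique _ H H0).
Qed.

(** The added 1 makes the integrand nonnegative, so that the integration lemmas for nonnegative
    functions apply. *)
Lemma integral_normal_cos (u : R) :
  (\int[normal_prob (0 : R) 1]_x (1 + cos (u * x + theta))%:E =
   (1 + cos theta * expR (- u ^+ 2 / 2))%:E)%E.
Proof.
have mcos : measurable_fun [set: R] (fun x => cos (u * x + theta)).
  apply: (measurableT_comp (continuous_measurable_fun (@continuous_cos R))).
  by apply: measurable_funD => //; exact: measurable_funM.
rewrite ge0_integral_normal_prob; last 2 first.
- by apply/measurable_EFinP; exact: measurable_funD.
- by move=> x; rewrite lee_fin -lerBlDl sub0r cos_geN1.
have pk : normal_peak (1 : R) != 0 by rewrite gt_eqF// normal_peak_gt0 ?oner_neq0.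
pose C := normal_peak (1 : R) * expR (- u ^+ 2 / 2).
transitivity (\int[leb]_x ((normal_pdf 0 1 x)%:E + C%:E * (phi u x)%:E))%E.
  apply: eq_integral => x _; rewrite -EFinM -[in RHS]EFinM -EFinD mulrDr mulr1.
  congr (_ + _)%:E; rewrite /C /phi.
  have -> : normal_pdf 0 1 x = normal_peak 1 * gauss x by rewrite gaussE mulrA
    mulfV// mul1r.
  have -> : gauss x = expR (- u ^+ 2 / 2) * expR (2^-1 * (u ^+ 2 - x ^+ 2)).
    by rewrite -expRD /gauss; congr expR; field.
  by ring.
rewrite integralD//=; last 2 first.
- exact: integrable_normal_pdf.
- by apply: integrableZl => //; exact: integrable_phi.
rewrite integral_normal_pdf integralZl//; last exact: integrable_phi.
have -> : (\int[leb]_x (phi u x)%:E = (\int[leb]_x phi 0 x)%:E)%E.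
  rewrite -(integral_phi_const u) /Rintegral fineK//.
  exact: integrable_fin_num (integrable_phi u).
have -> : \int[leb]_x phi 0 x = cos theta / normal_peak 1.
  rewrite (_ : phi 0 = fun x => (cos theta / normal_peak 1) * normal_pdf 0 1 x).
    by rewrite RintegralZl//; [rewrite /Rintegral integral_normal_pdf mulr1
      |exact: integrable_normal_pdf].
  apply/funext => x; rewrite /phi mul0r add0r -mulrA -gaussE//.
rewrite -EFinM -EFinD /C; congr (_ + _)%:E.
by field.
Qed.

End GaussianCharacteristicFunction.

Section GaussianVector.
Context {R : realType}.
Local Notation gamma := (normal_prob (0 : R) 1).

Definition tuple_cons {m : nat} (z : measurableTypeR R * m.-tuple R) : m.+1.-tuple R
  :=
  [tuple of z.1 :: z.2].

Lemma measurable_tuple_cons {m : nat} : measurable_fun [set: measurableTypeR R *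
  m.-tuple R] tuple_cons.
Proof. exact: (measurable_cons measurable_fst measurable_snd). Qed.

HB.instance Definition _ (m : nat) := isMeasurableFun.Build _ _ _ _
  (@tuple_cons m) measurable_tuple_cons.

(** The standard Gaussian law, built by prepending one independent coordinate at a time so that
    Tonelli's theorem drives inductions on [m]. The two successor lemmas below integrate first the
    tail, respectively the head coordinate. *)
Fixpoint gauss_vec (m : nat) : probability (m.-tuple R) R :=
  match m with
  | 0 => \d_ [tuple of [::]]
  | m'.+1 => distribution ((normal_prob 0 1 \x gauss_vec m')%E : probability
    (measurableTypeR R * m'.-tuple R)%type R)
                (@tuple_cons m')
  end.

Local Open Scope ereal_scope.

Lemma ge0_integral_gauss_vec0 (f : 0.-tuple R -> \bar R) :
  measurable_fun [set: 0.-tuple R] f ->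
  \int[gauss_vec 0]_t f t = f [tuple of [::]].
Proof. by move=> mf; rewrite integral_dirac// diracT mul1e. Qed.

Lemma ge0_integral_gauss_vecS (m : nat) (f : m.+1.-tuple R -> \bar R) :
  measurable_fun [set: m.+1.-tuple R] f -> (forall t, 0 <= f t) ->
  \int[gauss_vec m.+1]_t f t =
  \int[gamma]_x \int[gauss_vec m]_t f [tuple of x :: t].
Proof.
move=> mf f0; rewrite ge0_integral_distribution//.
rewrite fubini_tonelli1//; last by move=> z; exact: f0.
exact: (measurableT_comp mf measurable_tuple_cons).
Qed.

Lemma ge0_integral_gauss_vecS' (m : nat) (f : m.+1.-tuple R -> \bar R) :
  measurable_fun [set: m.+1.-tuple R] f -> (forall t, 0 <= f t) ->
  \int[gauss_vec m.+1]_t f t =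
  \int[gauss_vec m]_t \int[gamma]_x f [tuple of x :: t].
Proof.
move=> mf f0; rewrite ge0_integral_distribution//.
rewrite fubini_tonelli2//; last by move=> z; exact: f0.
exact: (measurableT_comp mf measurable_tuple_cons).
Qed.

End GaussianVector.

Section QuadraticForms.
Context {R : realType}.

Definition dotf {m : nat} (v x : 'I_m -> R) : R := \sum_i v i * x i.

Definition qf {m : nat} (H : 'I_m -> 'I_m -> R) (x : 'I_m -> R) : R :=
  \sum_i \sum_j H i j * x i * x j.

Definition behead_fun {m : nat} (x : 'I_m.+1 -> R) (i : 'I_m) : R :=
  x (lift ord0 i).

(* [1 + schur H] is the Schur complement of the top left entry of [1 + H]. *)
Definition schur {m : nat} (H : 'I_m.+1 -> 'I_m.+1 -> R) (i j : 'I_m) : R :=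
  H (lift ord0 i) (lift ord0 j) -
  behead_fun (H ord0) i * behead_fun (H ord0) j / (1 + H ord0 ord0).

Definition cons_fun {m : nat} (a : R) (x : 'I_m -> R) (i : 'I_m.+1) : R :=
  if unlift ord0 i is Some j then x j else a.

Lemma cons_fun0 {m : nat} a (x : 'I_m -> R) : cons_fun a x ord0 = a.
Proof. by rewrite /cons_fun unlift_none. Qed.

Lemma cons_funS {m : nat} a (x : 'I_m -> R) i : cons_fun a x (lift ord0 i) = x i.
Proof. by rewrite /cons_fun liftK. Qed.

Lemma dotf_cons {m : nat} (v : 'I_m.+1 -> R) a (x : 'I_m -> R) :
  dotf v (cons_fun a x) = v ord0 * a + dotf (behead_fun v) x.
Proof.
rewrite /dotf big_ord_recl cons_fun0; congr (_ + _).
by apply: eq_bigr => i _; rewrite cons_funS.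
Qed.

Lemma qf_cons {m : nat} (H : 'I_m.+1 -> 'I_m.+1 -> R) a (x : 'I_m -> R) :
  (forall i j, H i j = H j i) ->
  qf H (cons_fun a x) = H ord0 ord0 * a ^+ 2 + 2 * a * dotf (behead_fun (H ord0)) x
    +
    qf (fun i j => H (lift ord0 i) (lift ord0 j)) x.
Proof.
move=> symH; rewrite /qf big_ord_recl big_ord_recl !cons_fun0.
have -> : \sum_(i < m) H ord0 (lift ord0 i) * a * cons_fun a x (lift ord0 i) =
    a * dotf (behead_fun (H ord0)) x.
  by rewrite mulr_sumr; apply: eq_bigr => i _; rewrite cons_funS /behead_fun; ring.
have -> : \sum_(i < m) \sum_j H (lift ord0 i) j * cons_fun a x (lift ord0 i) *
  cons_fun a x j =
    a * dotf (behead_fun (H ord0)) x +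
    \sum_i \sum_j H (lift ord0 i) (lift ord0 j) * x i * x j.
  rewrite mulr_sumr -big_split/=; apply: eq_bigr => i _.
  rewrite big_ord_recl cons_fun0 !cons_funS; congr (_ + _).
    by rewrite symH /behead_fun; ring.
  by apply: eq_bigr => j _; rewrite cons_funS.
by ring.
Qed.

(** For symmetric H with corner entry h and 1 + h > 0, the right-hand side is the minimum over a of
    a^2 + [qf H (cons_fun a x)]. This is why semidefinite bounds on H pass to [schur H]. *)
Lemma qf_schur {m : nat} (H : 'I_m.+1 -> 'I_m.+1 -> R) (x : 'I_m -> R) :
  qf (schur H) x = qf (fun i j => H (lift ord0 i) (lift ord0 j)) x -
    dotf (behead_fun (H ord0)) x ^+ 2 / (1 + H ord0 ord0).
Proof.
rewrite /qf expr2 {1}/dotf !mulr_suml -sumrB; apply: eq_bigr => i _.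
rewrite /dotf mulr_sumr mulr_suml -sumrB; apply: eq_bigr => j _.
by rewrite /schur /behead_fun; ring.
Qed.

Lemma schur_sym {m : nat} (H : 'I_m.+1 -> 'I_m.+1 -> R) :
  (forall i j, H i j = H j i) -> forall i j, schur H i j = schur H j i.
Proof. by move=> symH i j; rewrite /schur symH; ring. Qed.

Lemma trace_schur {m : nat} (H : 'I_m.+1 -> 'I_m.+1 -> R) :
  \sum_i schur H i i = \sum_i H i i - H ord0 ord0 -
   dotf (behead_fun (H ord0)) (behead_fun (H ord0)) / (1 + H ord0 ord0).
Proof.
by rewrite [\sum_i H i i]big_ord_recl [X in X - _]addrAC subrr add0r /dotf mulr_suml
  -sumrB.
Qed.

Lemma tnth_cons {m : nat} (a : R) (t : m.-tuple R) :
  tnth [tuple of a :: t] = cons_fun a (tnth t).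
Proof.
apply/funext => i; case: (unliftP ord0 i) => [j ->|->].
  by rewrite cons_funS tnthS.
by rewrite cons_fun0 tnth0.
Qed.

End QuadraticForms.

Section GaussianVectorIntegrals.
Context {R : realType}.
Local Notation gamma := (normal_prob (0 : R) 1).

Lemma measurable_dotf {m : nat} (v : 'I_m -> R) :
  measurable_fun [set: m.-tuple R] (fun t => dotf v (tnth t)).
Proof.
apply: measurable_sum => i; apply: measurable_funM => //.
exact: measurable_tnth.
Qed.

Lemma measurable_qf {m : nat} (H : 'I_m -> 'I_m -> R) :
  measurable_fun [set: m.-tuple R] (fun t => qf H (tnth t)).
Proof.
apply: measurable_sum => i; apply: measurable_sum => j.
apply: measurable_funM; last exact: measurable_tnth.
by apply: measurable_funM => //; exact: measurable_tnth.
Qed.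

Local Open Scope ereal_scope.

(** The phase [theta] makes the induction work: once the first coordinate is fixed, its contribution
    is a phase for the others. *)
Lemma gauss_vec_cos (m : nat) (v : 'I_m -> R) (theta : R) :
  \int[gauss_vec m]_t (1 + cos (dotf v (tnth t) + theta))%:E =
  (1 + cos theta * expR (- (dotf v v) / 2))%:E.
Proof.
have mc k (w : 'I_k -> R) th : measurable_fun [set: k.-tuple R]
    (fun t => (1 + cos (dotf w (tnth t) + th))%:E).
  apply/measurable_EFinP; apply: measurable_funD => //.
  apply: (measurableT_comp (continuous_measurable_fun (@continuous_cos R))).
  by apply: measurable_funD => //; exact: measurable_dotf.
have c0 (x : R) : 0 <= (1 + cos x)%:E.
  by rewrite lee_fin -lerBlDl sub0r cos_geN1.
elim: m v theta => [|m IH] v theta.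
  rewrite ge0_integral_gauss_vec0; last exact: mc.
  by rewrite /dotf !big_ord0 oppr0 mul0r expR0 mulr1 add0r.
rewrite ge0_integral_gauss_vecS; [|exact: mc|by move=> t; exact: c0].
pose C := expR (- dotf (behead_fun v) (behead_fun v) / 2).
have C1 : (C <= 1)%R.
  rewrite -expR0 ler_expR mulNr oppr_le0 mulr_ge0// sumr_ge0// => i _.
  by rewrite -expr2 sqr_ge0.
have mcos : measurable_fun [set: R] (fun x => (1 + cos (v ord0 * x + theta))%:E).
  apply/measurable_EFinP; apply: measurable_funD => //.
  apply: (measurableT_comp (continuous_measurable_fun (@continuous_cos R))).
  by apply: measurable_funD => //; exact: measurable_funM.
(* This splits 1 + C cos into nonnegative terms, which is possible because C <= 1. *)
transitivity (\int[gamma]_x ((1 - C)%:E + C%:E * (1 + cos (v ord0 * x +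
  theta))%:E)).
  apply: eq_integral => x _.
  under eq_integral do rewrite tnth_cons dotf_cons addrAC addrC.
  by rewrite IH -/C -EFinM -EFinD; congr EFin; ring.
rewrite ge0_integralD//; last by apply: emeasurable_funM.
have g1 : gamma setT = 1 by exact: probability_setT.
rewrite integral_cst// [X in _ * X]g1 mule1 ge0_integralZl_EFin//;
  last by rewrite expR_ge0.
rewrite integral_normal_cos -EFinM -EFinD; congr EFin.
rewrite {1}/dotf big_ord_recl -/(dotf (behead_fun v) (behead_fun v)).
rewrite opprD mulrDl expRD -/C expr2 -mulNr; ring.
- by move=> x _; rewrite lee_fin subr_ge0.
- by move=> x _; rewrite mule_ge0 ?c0// lee_fin expR_ge0.
Qed.

(** One step of Gaussian elimination: the identity det (1 + H) = (1 + h) det (1 + schur H) at the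
    level of integrals, obtained by integrating out the first coordinate. *)
Lemma gauss_vec_quad_schur (m : nat) (H : 'I_m.+1 -> 'I_m.+1 -> R) :
  (forall i j, H i j = H j i) -> (0 < 1 + H ord0 ord0)%R ->
  \int[gauss_vec m.+1]_t (expR (- qf H (tnth t) / 2))%:E =
  ((Num.sqrt (1 + H ord0 ord0))^-1)%:E *
    \int[gauss_vec m]_t (expR (- qf (schur H) (tnth t) / 2))%:E.
Proof.
move=> symH h0.
have mq k (G : 'I_k -> 'I_k -> R) : measurable_fun [set: k.-tuple R]
    (fun t => (expR (- qf G (tnth t) / 2))%:E).
  apply/measurable_EFinP; apply: measurableT_comp => //.
  apply: measurable_funM => //; apply: measurableT_comp => //.
  exact: measurable_qf.
rewrite ge0_integral_gauss_vecS'; [|exact: mq|by move=> t;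
  rewrite lee_fin expR_ge0].
rewrite -ge0_integralZl_EFin//; last exact: mq.
apply: eq_integral => t _.
pose b := (- dotf (behead_fun (H ord0)) (tnth t))%R.
transitivity ((expR (- qf (fun i j => H (lift ord0 i) (lift ord0 j)) (tnth t) /
  2))%:E *
  \int[gamma]_x (expR (- (H ord0 ord0 * x ^+ 2) / 2 + b * x))%:E).
  rewrite -ge0_integralZl_EFin//; last first.
    apply/measurable_EFinP; apply: measurableT_comp => //.
    apply: measurable_funD; last exact: measurable_funM.
    apply: measurable_funM => //; apply: measurableT_comp => //.
    by apply: measurable_funM => //; exact: measurable_funX.
  apply: eq_integral => x _; rewrite -EFinM -expRD tnth_cons qf_cons//.
  by congr (expR _)%:E; rewrite /b; field.
rewrite integral_normal_expR_quad// -!EFinM; congr EFin.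
rewrite mulrCA; congr (_ * _)%R; rewrite -expRD; congr expR.
rewrite qf_schur /b sqrrN; field.
by rewrite gt_eqF.
Qed.

End GaussianVectorIntegrals.

Section GaussianQuadraticBounds.
Context {R : realType}.

Lemma expR_le_onePx (h : R) : 0 <= h -> expR (h - 2^-1 * h ^+ 2) <= 1 + h.
Proof.
move=> h0; rewrite -subr_ge0.
refine (@ge0_of_derive _ (fun h => (1 + h) - expR (h - 2^-1 * h ^+ 2))
  (fun h => 1 - (1 - h) * expR (h - 2^-1 * h ^+ 2)) _ _ _ h h0).
- move=> x; apply: is_derive_eq.
  by rewrite /GRing.scale/=; field.
- by rewrite addr0 expr0n/= mulr0 subr0 expR0 subrr.
- move=> x x0; rewrite subr_ge0.
  apply: (@le_trans _ _ (expR (- x) * expR (x - 2^-1 * x ^+ 2))).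
    by rewrite ler_pM2r ?expR_gt0// expR_ge1Dx.
  by rewrite -expRD -expR0 ler_expR addrA addNr add0r oppr_le0 mulr_ge0// sqr_ge0.
Qed.

Lemma sqrtV_le (c y : R) : 0 < c -> 0 <= y -> c^-1 <= y ^+ 2 -> (Num.sqrt c)^-1 <=
  y.
Proof.
move=> c0 y0 cy; rewrite -ler_sqr ?nnegrE ?invr_ge0 ?sqrtr_ge0//.
by rewrite exprVn sqr_sqrtr// ltW.
Qed.

(** At the minimizing first coordinate a = - c / (1 + h), [qf (schur H) x] equals a^2 +
    [qf H (cons_fun a x)]. *)
Lemma qf_schur_ge0 {m : nat} (H : 'I_m.+1 -> 'I_m.+1 -> R) :
  (forall i j, H i j = H j i) -> (forall x, 0 <= qf H x) -> forall x,
    0 <= qf (schur H) x.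
Proof.
move=> symH H0 x.
have h0 : 0 <= H ord0 ord0.
  have := H0 (cons_fun 1 (fun=> 0)); rewrite qf_cons//.
  rewrite /dotf /qf !big1 ?expr1n ?mulr1 ?mulr0 ?addr0// => i _.
  - by rewrite big1// => j _; rewrite mulr0.
  - by rewrite mulr0.
rewrite qf_schur; set c := dotf _ x; set q := qf _ x; set h := H ord0 ord0 in h0 *.
have := H0 (cons_fun (- c / (1 + h)) x); rewrite qf_cons// -/c -/q -/h.
suff : 0 <= c ^+ 2 / (1 + h) ^+ 2.
  have h1 : 1 + h != 0 by rewrite gt_eqF// ltr_pwDl.
  move=> k1 k2; rewrite (_ : q - _ = h * (- c / (1 + h)) ^+ 2 + 2 * (- c / (1 + h))
    * c + q + c ^+ 2 / (1 + h) ^+ 2).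
    by rewrite addr_ge0.
  by field.
by rewrite divr_ge0// sqr_ge0.
Qed.

(** The integral is det (1 + H)^(-1/2), so on eigenvalues the bound is log (1 + x) >= x - x^2 / 2
    for x >= 0. Induction through Schur complements replaces diagonalization. *)
Lemma gauss_vec_exp_psd (m : nat) (H : 'I_m -> 'I_m -> R) :
  (forall i j, H i j = H j i) -> (forall x, 0 <= qf H x) ->
  (\int[gauss_vec m]_t (expR (- qf H (tnth t) / 2))%:E <=
   (expR (- (\sum_i H i i) / 2 + (\sum_i \sum_j H i j ^+ 2) / 4))%:E)%E.
Proof.
elim: m H => [|m IH] H symH H0.
  rewrite ge0_integral_gauss_vec0.
    by rewrite /qf !big_ord0 oppr0 !mul0r addr0.
  apply/measurable_EFinP; apply: measurableT_comp => //.
  apply: measurable_funM => //; apply: measurableT_comp => //.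
  exact: measurable_qf.
have h0 : 0 <= H ord0 ord0.
  have := H0 (cons_fun 1 (fun=> 0)); rewrite qf_cons//.
  rewrite /dotf /qf !big1 ?expr1n ?mulr1 ?mulr0 ?addr0// => i _.
  - by rewrite big1// => j _; rewrite mulr0.
  - by rewrite mulr0.
rewrite gauss_vec_quad_schur//; last by rewrite ltr_pwDl.
have psdS := qf_schur_ge0 symH H0.
have {}IH := IH _ (schur_sym symH) psdS.
set h := H ord0 ord0 in h0 *; set b := behead_fun (H ord0).
apply: (@le_trans _ _ ((expR (- h / 2 + h ^+ 2 / 4))%:E *
    (expR (- (\sum_i schur H i i) / 2 + (\sum_i \sum_j schur H i j ^+ 2) /
      4))%:E)%E).
  apply: lee_pmul => //.
    by apply: integral_ge0 => t _; rewrite lee_fin expR_ge0.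
  rewrite lee_fin; apply: sqrtV_le; rewrite ?ltr_pwDl ?expR_ge0//.
  rewrite -expRM_natl -[leRHS]invrK -expRN lef_pV2 ?posrE ?expR_gt0 ?ltr_pwDl//.
  apply: le_trans (expR_le_onePx h0); rewrite ler_expR; lra.
rewrite -EFinM -expRD lee_fin ler_expR.
pose H' i j := H (lift ord0 i) (lift ord0 j).
have E1 : \sum_i \sum_j H i j ^+ 2 = h ^+ 2 + 2 * dotf b b + \sum_i \sum_j H' i j ^+
  2.
  rewrite big_ord_recl big_ord_recl -/h.
  have -> : \sum_(i < m) H ord0 (lift ord0 i) ^+ 2 = dotf b b.
    by apply: eq_bigr => i _; rewrite expr2.
  under [X in _ + X = _]eq_bigr do rewrite big_ord_recl.
  rewrite big_split/=.
  have -> : \sum_(i < m) H (lift ord0 i) ord0 ^+ 2 = dotf b b.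
    by apply: eq_bigr => i _; rewrite symH expr2.
  by rewrite /H'; ring.
have E2 : \sum_i \sum_j schur H i j ^+ 2 = \sum_i \sum_j H' i j ^+ 2 -
    2 / (1 + h) * qf H' b + dotf b b ^+ 2 / (1 + h) ^+ 2.
  rewrite /qf [dotf b b ^+ 2]expr2 {1}/dotf !mulr_suml mulr_sumr -sumrB
    -big_split/=.
  apply: eq_bigr => i _; rewrite /dotf mulr_sumr mulr_suml mulr_sumr -sumrB
    -big_split/=.
  apply: eq_bigr => j _; rewrite /schur -/b -/h -/(H' i j); field.
  by rewrite gt_eqF// ltr_pwDl.
rewrite E1 E2 trace_schur -/h -/b.
(* Positivity of the Schur complement at [b] gives q >= |b|^4 / (1 + h), so the cross term - 2 q /
   (1 + h) of its squared norm absorbs |b|^4 / (1 + h)^2. *)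
have := psdS b; rewrite qf_schur -/h -/b -/H'.
have b0 : 0 <= dotf b b by rewrite /dotf sumr_ge0// => i _; rewrite -expr2 sqr_ge0.
move: (dotf b b) b0 (qf H' b) => bb b0 q; rewrite subr_ge0 => qb.
set S := \sum_i \sum_j _; set T := \sum_i _.
have h1 : 0 < 1 + h by rewrite ltr_pwDl.
have k1 : bb / (1 + h) <= bb by rewrite ler_pdivrMr// ler_peMr// lerDl.
have k2 : bb ^+ 2 / (1 + h) ^+ 2 <= 1 / (1 + h) * q.
  rewrite (_ : bb ^+ 2 / (1 + h) ^+ 2 = 1 / (1 + h) * (bb ^+ 2 / (1 + h))).
    by rewrite ler_wpM2l// divr_ge0 ?ltW.
  by field; rewrite gt_eqF.
have k3 : 0 <= 1 / (1 + h) * q.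
  by rewrite (le_trans _ k2)// divr_ge0// sqr_ge0.
rewrite (_ : 2 / (1 + h) * q = 2 * (1 / (1 + h) * q)); last by ring.
move: (1 / (1 + h) * q) (bb ^+ 2 / (1 + h) ^+ 2) (bb / (1 + h)) k1 k2 k3 => A B C k1
  k2 k3.
lra.
Qed.

(** On an eigenvalue - x with 0 <= x <= 1/2 this is (1 - x)^(-1/2) <= exp x. The lower bound - 1/2
    keeps 1 + H positive and is inherited by Schur complements. *)
Lemma gauss_vec_exp_le_half (m : nat) (H : 'I_m -> 'I_m -> R) :
  (forall i j, H i j = H j i) -> (forall x, qf H x <= 0) ->
  (forall x, - (dotf x x) / 2 <= qf H x) ->
  (\int[gauss_vec m]_t (expR (- qf H (tnth t) / 2))%:E <=
   (expR (- (\sum_i H i i)))%:E)%E.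
Proof.
elim: m H => [|m IH] H symH H0 Hh.
  rewrite ge0_integral_gauss_vec0.
    by rewrite /qf !big_ord0 oppr0 !mul0r.
  apply/measurable_EFinP; apply: measurableT_comp => //.
  apply: measurable_funM => //; apply: measurableT_comp => //.
  exact: measurable_qf.
set h := H ord0 ord0; set b := behead_fun (H ord0).
pose H' i j := H (lift ord0 i) (lift ord0 j).
have dc a (x : 'I_m -> R) : dotf (cons_fun a x) (cons_fun a x) = a ^+ 2 + dotf x x.
  rewrite dotf_cons cons_fun0 -expr2; congr (_ + _); congr dotf.
  by apply/funext => i; rewrite /behead_fun cons_funS.
have d0 x : dotf x (fun=> 0) = 0 :> R by rewrite /dotf big1// => i _; rewrite mulr0.
have q0 : qf H' (fun=> 0) = 0.
  by rewrite /qf big1// => i _; rewrite big1// => j _; rewrite mulr0.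
have h0 : h <= 0.
  have := H0 (cons_fun 1 (fun=> 0)); rewrite qf_cons// d0 -/H' q0 -/h.
  by rewrite expr1n !mulr1 mulr0 !addr0.
have h2 : - (1/2) <= h.
  have := Hh (cons_fun 1 (fun=> 0)); rewrite qf_cons// d0 -/H' q0 -/h dc d0.
  by rewrite expr1n !mulr1 mulr0 !addr0; lra.
have h1 : 0 < 1 + h by lra.
rewrite gauss_vec_quad_schur//.
have S0 x : qf (schur H) x <= 0.
  rewrite qf_schur -/H' -/h; have := H0 (cons_fun 0 x); rewrite qf_cons// -/H'.
  have : 0 <= dotf (behead_fun (H ord0)) x ^+ 2 / (1 + h) by rewrite divr_ge0
    ?sqr_ge0// ltW.
  by rewrite expr0n/= !mulr0 mul0r !add0r; lra.
have Sh x : - dotf x x / 2 <= qf (schur H) x.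
  rewrite qf_schur -/H' -/h -/b; set c := dotf b x.
  have := Hh (cons_fun (- c / (1 + h)) x); rewrite qf_cons//
    dc -/H' -/b -/h -/c => k.
  rewrite -subr_ge0 (_ : _ - _ = h * (- c / (1 + h)) ^+ 2 + 2 * (- c / (1 + h)) * c
    + qf H' x -
    (- ((- c / (1 + h)) ^+ 2 + dotf x x) / 2) + 1/2 * (c / (1 + h)) ^+ 2);
      last by field; rewrite gt_eqF.
  by rewrite addr_ge0 ?subr_ge0// mulr_ge0// sqr_ge0.
have {}IH := IH _ (schur_sym symH) S0 Sh.
(* This says that the corner entry of H (H + 1/2) is nonpositive. With e the first basis vector, the
   two test vectors are (H + 1/2) e and H e, and H (H + 1/2) H - (H + 1/2) H (H + 1/2) = - H (H +
   1/2) / 2. *)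
have bb : dotf b b <= - h / 2 - h ^+ 2.
  have := H0 (cons_fun (h + 1/2) b); have := Hh (cons_fun h b).
  rewrite !qf_cons// -/H' -/h -/b dc.
  nra.
apply: (@le_trans _ _ ((expR (2^-1 * (- h / (1 + h))))%:E *
    (expR (- (\sum_i schur H i i)))%:E)%E).
  apply: lee_pmul => //.
    by apply: integral_ge0 => t _; rewrite lee_fin expR_ge0.
  (* Here 1 / (1 + h) = 1 + y <= exp y with y = - h / (1 + h). *)
  rewrite lee_fin; apply: sqrtV_le; rewrite ?expR_ge0//.
  rewrite -expRM_natl mulrA divff ?pnatr_eq0// mul1r.
  apply: le_trans (expR_ge1Dx _).
  by rewrite le_eqVlt; apply/orP; left; apply/eqP; rewrite -/h; field;
    rewrite gt_eqF.
rewrite -EFinM -expRD lee_fin ler_expR trace_schur -/h -/b.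
set T := \sum_i _.
rewrite -subr_ge0 (_ : _ - _ = ((- h) * (1 + h) + h / 2 - dotf b b) / (1 + h));
  last first.
  by field; rewrite gt_eqF.
by rewrite divr_ge0 ?(ltW h1)//; lra.
Qed.

End GaussianQuadraticBounds.

(** * Fourth-moment bound for characteristic functions *)

Section Expectation.
Context d (T : measurableType d) (R : realType) (P : probability T R).
Local Notation intg f := (P.-integrable [set: T] (EFin \o f)).

Lemma intgD (f g : T -> R) : intg f -> intg g -> intg (fun x => f x + g x).
Proof. exact: integrableD. Qed.

Lemma intgZ (c : R) (f : T -> R) : intg f -> intg (fun x => c * f x).
Proof. exact: integrableZl. Qed.

Lemma intg_cst (c : R) : intg (fun=> c).
Proof. exact: finite_measure_integrable_cst. Qed.

Lemma intg_sum I (s : seq I) (f : I -> T -> R) : (forall i, intg (f i)) ->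
  intg (fun x => \sum_(i <- s) f i x).
Proof.
move=> fi; rewrite (_ : _ \o _ = fun x => (\sum_(i <- s) (f i x)%:E)%E).
  by apply: integrable_sum => // i _; exact: fi.
by apply/funext => x /=; rewrite sumEFin.
Qed.

Lemma intg_bounded (f : T -> R) (c : R) : measurable_fun [set: T] f ->
  (forall x, `|f x| <= c) -> intg f.
Proof.
move=> mf fc; apply: (le_integrable measurableT _ _ (intg_cst c)).
- exact/measurable_EFinP.
- by move=> x _ /=; rewrite lee_fin (le_trans (fc x))// ler_norm.
Qed.

Lemma intg_le (f g : T -> R) : measurable_fun [set: T] f ->
  (forall x, `|f x| <= g x) -> intg g -> intg f.
Proof.
move=> mf fg; apply: le_integrable => //; first exact/measurable_EFinP.
by move=> x _ /=; rewrite lee_fin (le_trans (fg x))// ler_norm.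
Qed.

Lemma intg_measurable (f : T -> R) : intg f -> measurable_fun [set: T] f.
Proof. by move=> /measurable_int/measurable_EFinP. Qed.

Lemma RintgD (f g : T -> R) : intg f -> intg g ->
  \int[P]_x (f x + g x) = \int[P]_x f x + \int[P]_x g x.
Proof. by move=> fi gi; rewrite RintegralD. Qed.

Lemma RintgB (f g : T -> R) : intg f -> intg g ->
  \int[P]_x (f x - g x) = \int[P]_x f x - \int[P]_x g x.
Proof. by move=> fi gi; rewrite RintegralB. Qed.

Lemma RintgZ (c : R) (f : T -> R) : intg f -> \int[P]_x (c * f x) = c * \int[P]_x f
  x.
Proof. by move=> fi; rewrite RintegralZl. Qed.

Lemma Rintg_cst (c : R) : \int[P]_x c = c.
Proof.
have p1 : P [set: T] = 1%E by exact: probability_setT.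
by rewrite /Rintegral integral_cst// [X in (_ * X)%E]p1 mule1.
Qed.

Lemma Rintg_sum I (s : seq I) (f : I -> T -> R) : (forall i, intg (f i)) ->
  \int[P]_x (\sum_(i <- s) f i x) = \sum_(i <- s) \int[P]_x f i x.
Proof.
move=> fi; elim: s => [|i s IH].
  by under eq_Rintegral do rewrite big_nil; rewrite Rintg_cst big_nil.
under eq_Rintegral do rewrite big_cons.
by rewrite RintgD ?IH ?big_cons//; exact: intg_sum.
Qed.

Lemma le_Rintg (f g : T -> R) : intg f -> intg g -> (forall x, f x <= g x) ->
  \int[P]_x f x <= \int[P]_x g x.
Proof. by move=> fi gi fg; apply: le_Rintegral. Qed.

Lemma EFin_Rintg (f : T -> R) : intg f -> (\int[P]_x f x)%:E = (\int[P]_x (f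
  x)%:E)%E.
Proof. by move=> fi; rewrite /Rintegral fineK//; exact: integrable_fin_num. Qed.

End Expectation.

Section CharacteristicFunctionBound.
Context d (T : measurableType d) (R : realType) (P : probability T R).
Variable Y : T -> R.
Hypothesis mY : measurable_fun [set: T] Y.
Local Notation intg f := (P.-integrable [set: T] (EFin \o f)).

Let C := \int[P]_x cos (Y x).
Let S := \int[P]_x sin (Y x).

Lemma measurable_cos_comp : measurable_fun [set: T] (fun x => cos (Y x)).
Proof. exact: (measurableT_comp (continuous_measurable_fun (@continuous_cos R))).
  Qed.

Lemma measurable_sin_comp : measurable_fun [set: T] (fun x => sin (Y x)).
Proof. exact: (measurableT_comp (continuous_measurable_fun (@continuous_sin R))).
  Qed.

Lemma intg_cos : intg (fun x => cos (Y x)).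
Proof. by apply: intg_bounded measurable_cos_comp _ => x; exact: cos_max. Qed.

Lemma intg_sin : intg (fun x => sin (Y x)).
Proof. by apply: intg_bounded measurable_sin_comp _ => x; exact: sin_max. Qed.

Let Rintg_cossin a b : \int[P]_x (a * cos (Y x) + b * sin (Y x)) = a * C + b * S.
Proof.
rewrite RintgD; last 2 first.
- exact: intgZ intg_cos.
- exact: intgZ intg_sin.
by rewrite !RintgZ//; [exact: intg_sin|exact: intg_cos].
Qed.

Let intg_cossin a b : intg (fun x => a * cos (Y x) + b * sin (Y x)).
Proof. by apply: intgD; apply: intgZ; [exact: intg_cos|exact: intg_sin]. Qed.

(** C^2 + S^2 is E cos (Y - Y') for an independent copy Y'. Integrating twice over the same space
    avoids a product space: C cos y + S sin y is the integral of cos (y - Y), and it is then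
    integrated at y = Y. *)
Lemma char_sqr_le1 : C ^+ 2 + S ^+ 2 <= 1.
Proof.
have H y : cos y * C + sin y * S <= 1.
  rewrite -Rintg_cossin -[leRHS](Rintg_cst P) le_Rintg//.
  - exact: intg_cst.
  - by move=> x; rewrite -cosB cos_le1.
rewrite !expr2 -Rintg_cossin -[leRHS](Rintg_cst P) le_Rintg//;
  first exact: intg_cst.
by move=> x; rewrite mulrC [S * _]mulrC H.
Qed.

Hypothesis Y4 : intg (fun x => Y x ^+ 4).

Let Y3 : intg (fun x => Y x ^+ 3).
Proof.
apply: (@intg_le _ _ _ P _ (fun x => 1 + Y x ^+ 4)).
- exact: measurable_funX.
- by move=> x; rewrite ler_norml; apply/andP; split; move: (Y x) => y;
    have := sqr_ge0 (y ^+ 2 - y); have := sqr_ge0 (y ^+ 2 + y); have :=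
      sqr_ge0 (y ^+ 2 - 1);
    have := sqr_ge0 (y - 1); have := sqr_ge0 (y + 1); lra.
- by apply: intgD => //; exact: intg_cst.
Qed.

Let Y2 : intg (fun x => Y x ^+ 2).
Proof.
apply: (@intg_le _ _ _ P _ (fun x => 1 + Y x ^+ 4)).
- exact: measurable_funX.
- by move=> x; rewrite ler_norml; apply/andP; split; move: (Y x) => y;
    have := sqr_ge0 (y ^+ 2 - y); have := sqr_ge0 (y ^+ 2 + y); have :=
      sqr_ge0 (y ^+ 2 - 1);
    have := sqr_ge0 (y - 1); have := sqr_ge0 (y + 1); lra.
- by apply: intgD => //; exact: intg_cst.
Qed.

Let Y1 : intg Y.
Proof.
apply: (@intg_le _ _ _ P _ (fun x => 1 + Y x ^+ 2)) => //.
- by move=> x; rewrite ler_norml; apply/andP; split; move: (Y x) => y;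
    have := sqr_ge0 (y ^+ 2 - y); have := sqr_ge0 (y ^+ 2 + y); have :=
      sqr_ge0 (y ^+ 2 - 1);
    have := sqr_ge0 (y - 1); have := sqr_ge0 (y + 1); lra.
- by apply: intgD => //; exact: intg_cst.
Qed.

Hypothesis Y0 : \int[P]_x Y x = 0.
Let m2 := \int[P]_x (Y x ^+ 2).
Let m3 := \int[P]_x (Y x ^+ 3).
Let m4 := \int[P]_x (Y x ^+ 4).

Let intg_poly4 a0 a1 a2 a3 a4 :
  intg (fun x => a0 + a1 * Y x + a2 * Y x ^+ 2 + a3 * Y x ^+ 3 + a4 * Y x ^+ 4).
Proof.
by do 4 (apply: intgD; last exact: intgZ); exact: intg_cst.
Qed.

Let Rintg_poly4 a0 a1 a2 a3 a4 :
  \int[P]_x (a0 + a1 * Y x + a2 * Y x ^+ 2 + a3 * Y x ^+ 3 + a4 * Y x ^+ 4) =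
  a0 + a2 * m2 + a3 * m3 + a4 * m4.
Proof.
have i0 := intg_cst P a0.
have i1 := intgD i0 (intgZ a1 Y1).
have i2 := intgD i1 (intgZ a2 Y2).
have i3 := intgD i2 (intgZ a3 Y3).
have i4 := intgZ a4 Y4.
rewrite (RintgD i3 i4) (RintgD i2 (intgZ a3 Y3)) (RintgD i1 (intgZ a2 Y2)).
by rewrite (RintgD i0 (intgZ a1 Y1)) !RintgZ// Rintg_cst Y0 mulr0 addr0.
Qed.

(* Integrate [cos (y - y') <= 1 - (y - y')^2/2 + (y - y')^4/24] over two
   independent copies of [Y]: symmetrization removes the odd moments. *)
Lemma char_sqr_le : C ^+ 2 + S ^+ 2 <= 1 - m2 + (m4 + 3 * m2 ^+ 2) / 12.
Proof.
have H y : C * cos y + S * sin y <=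
    (1 - 2^-1 * m2 + 24^-1 * m4) + (- 6^-1 * m3) * y + (4^-1 * m2 - 2^-1) * y ^+ 2 +
      0 * y ^+ 3 + 24^-1 * y ^+ 4.
  rewrite [C * _]mulrC [S * _]mulrC -Rintg_cossin.
  rewrite [leRHS](_ : _ = \int[P]_x ((1 - 2^-1 * y ^+ 2 + 24^-1 * y ^+ 4) +
     (y - 6^-1 * y ^+ 3) * Y x + (4^-1 * y ^+ 2 - 2^-1) * Y x ^+ 2 + (- 6^-1 * y) *
       Y x ^+ 3 + 24^-1 * Y x ^+ 4)).
    apply: le_Rintg; [exact: intg_cossin|exact: intg_poly4|move=> x].
    rewrite -cosB (le_trans (cos_le_taylor4 _))//.
    by rewrite le_eqVlt; apply/orP; left; apply/eqP; field.
  by rewrite Rintg_poly4; ring.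
have := le_Rintg (intg_cossin C S) (intg_poly4 _ _ _ _ _) (fun x => H (Y x)).
by rewrite Rintg_poly4 Rintg_cossin; lra.
Qed.

Lemma sqr_m2_le : m2 ^+ 2 <= m4.
Proof.
have : 0 <= \int[P]_x (m2 ^+ 2 + 0 * Y x + (- 2 * m2) * Y x ^+ 2 + 0 * Y x ^+ 3 + 1
  * Y x ^+ 4).
  apply: Rintegral_ge0 => x _.
  rewrite (_ : _ + _ = (m2 - Y x ^+ 2) ^+ 2) ?sqr_ge0//; ring.
by rewrite Rintg_poly4; nra.
Qed.

(** As m2^2 <= m4 <= a^2, the remainder (m4 + 3 m2^2) / 12 is at most a^2 / 3. *)
Lemma char_sqr_le_expR (a : R) : 0 <= a -> m4 <= a ^+ 2 ->
  C ^+ 2 + S ^+ 2 <= expR (- m2 + a ^+ 2 / 3).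
Proof.
move=> a0 m4a; apply: le_trans (expR_ge1Dx _); apply: le_trans char_sqr_le _.
by have := sqr_m2_le; lra.
Qed.

End CharacteristicFunctionBound.

Section FourthPower.
Context d (T : measurableType d) (R : realType) (P : probability T R).
Local Notation intg f := (P.-integrable [set: T] (EFin \o f)).

Lemma intg4_sum I (s : seq I) (f : I -> T -> R) :
  (forall i, measurable_fun [set: T] (f i)) -> (forall i,
    intg (fun x => f i x ^+ 4)) ->
  intg (fun x => (\sum_(i <- s) f i x) ^+ 4).
Proof.
move=> mf f4; elim: s => [|i s IH].
  rewrite (_ : EFin \o _ = EFin \o fun=> 0); first exact: intg_cst.
  by apply/funext => x /=; rewrite big_nil expr0n.
apply: (@intg_le _ _ _ P _ (fun x => 8 * (f i x ^+ 4) + 8 * (\sum_(j <- s) f j x) ^+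
  4)).
- apply: measurable_funX; under eq_fun do rewrite big_cons.
  by apply: measurable_funD => //; exact: measurable_sum.
- move=> x; rewrite big_cons; move: (f i x) (\sum_(j <- s) _) => y z.
  rewrite ger0_norm; last by rewrite (exprM _ 2 2) sqr_ge0.
  have H (u v : R) : (u + v) ^+ 2 <= 2 * u ^+ 2 + 2 * v ^+ 2.
    by have := sqr_ge0 (u - v); lra.
  have := H (y ^+ 2) (z ^+ 2); have := H y z.
  have : 0 <= (y + z) ^+ 2 by exact: sqr_ge0.
  rewrite (exprM (y + z) 2 2) (exprM y 2 2) (exprM z 2 2).
  move: ((y + z) ^+ 2) (y ^+ 2) (z ^+ 2) => a b c a0 h1 h2.
  have : a ^+ 2 <= (2 * b + 2 * c) ^+ 2 by rewrite lerXn2r// nnegrE (le_trans a0).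
  lra.
- by apply: intgD; apply: intgZ.
Qed.

End FourthPower.

(** * Independent random variables *)

Section WeightedExpectation.
Context d1 d2 (T : measurableType d1) (U : measurableType d2) (R : realType)
  (P : probability T R) (Y : {RV P >-> U}).
Local Notation intg f := (P.-integrable [set: T] (EFin \o f)).

Lemma measurable_indic_comp (C : set U) : measurable C ->
  measurable_fun [set: T] (fun x => \1_C (Y x) : R).
Proof. by move=> mC; apply: (measurableT_comp (measurable_indic mC)). Qed.

Section weight.
Variables (G : T -> R) (kappa : R).
Hypotheses (G0 : forall x, 0 <= G x) (iG : intg G).
(** With [C] the whole space, [kappa] is the expectation of [G]: the hypothesis says that [G] is
    uncorrelated with every event of [Y], and the section extends this to integrable functions of
    [Y]. *)
Hypothesis GY : forall C, measurable C ->
  \int[P]_x (G x * \1_C (Y x)) = kappa * \int[P]_x \1_C (Y x).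

Let mG : measurable_fun [set: T] G. Proof. exact: intg_measurable iG. Qed.

Let kappa0 : 0 <= kappa.
Proof.
have := GY measurableT.
have -> : \int[P]_x (\1_[set: U] (Y x)) = 1 :> R.
  by under eq_Rintegral do rewrite indicT; exact: Rintg_cst.
by rewrite mulr1 => <-; apply: Rintegral_ge0 => x _; rewrite mulr_ge0.
Qed.

Let intg_indic C : measurable C -> intg (fun x => \1_C (Y x)).
Proof.
move=> mC; apply: (intg_bounded _ (c := 1)); first exact: measurable_indic_comp.
by move=> x; rewrite indicE; case: (_ \in _); rewrite ?normr1 ?normr0.
Qed.

Let ge0_weight (g : U -> R) : measurable_fun [set: U] g -> (forall y, 0 <= g y) ->
  (\int[P]_x (G x * g (Y x))%:E = kappa%:E * \int[P]_x (g (Y x))%:E)%E.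
Proof.
move=> mg g0.
have mge : measurable_fun [set: U] (EFin \o g) by exact/measurable_EFinP.
transitivity (\int[mscale (NngNum kappa0) (distribution P Y)]_y (g y)%:E)%E;
  last first.
  rewrite ge0_integral_mscale//; last by move=> y _; rewrite lee_fin.
  by rewrite ge0_integral_distribution// => y; rewrite lee_fin.
rewrite -(@ge0_integral_weight _ _ _ _ _ P _ Y G)//.
move=> B mB.
rewrite -EFin_Rintg; last first.
  apply: (intg_le _ (g := G)) => //.
    by apply: measurable_funM => //; exact: measurable_indic_comp.
  by move=> x; rewrite indicE normrM (ger0_norm (G0 x)); case: (_ \in _);
    rewrite ?normr1 ?normr0 ?mulr1 ?mulr0.
rewrite GY// EFinM EFin_Rintg//; last exact: intg_indic.
rewrite /mscale/=; congr (_ * _)%E.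
rewrite (_ : (fun x => _) = fun x => (\1_(Y @^-1` B) x)%:E)//.
by rewrite integral_indic ?setIT//; rewrite -[X in measurable X]setTI;
  exact: measurable_funP.
Qed.

Lemma intg_weight (f : U -> R) : measurable_fun [set: U] f -> intg (f \o Y) ->
  intg (fun x => G x * f (Y x)).
Proof.
move=> mf iF; apply/integrableP; split.
  apply/measurable_EFinP; apply: measurable_funM => //.
  exact: (measurableT_comp mf).
rewrite (_ : (fun x => _) = fun x => (G x * `|f (Y x)|)%:E); last first.
  by apply/funext => x /=; rewrite normrM (ger0_norm (G0 x)).
rewrite (@ge0_weight (fun y => `|f y|))//; last exact: measurableT_comp.
move/integrableP : iF => [_ iF].
by rewrite lte_mul_pinfty// lee_fin.
Qed.

Lemma Rintg_weight (f : U -> R) : measurable_fun [set: U] f -> intg (f \o Y) ->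
  \int[P]_x (G x * f (Y x)) = kappa * \int[P]_x f (Y x).
Proof.
move=> mf iF.
have mnf : measurable_fun [set: U] (fun y => `|f y|) by exact: measurableT_comp.
have infY : intg (fun x => `|f (Y x)|) by exact: (integrable_norm iF).
have iGf := intg_weight mf iF; have iGnf := intg_weight mnf infY.
(* Signed [f] are reached through the nonnegative functions |f| + s f, by comparing s = 1 with s =
   0. *)
have H (s : R) : `|s| <= 1 -> \int[P]_x (G x * `|f (Y x)| + s * (G x * f (Y x))) =
    kappa * \int[P]_x (`|f (Y x)| + s * f (Y x)).
  move=> s1; apply: EFin_inj; rewrite EFinM !EFin_Rintg.
  - rewrite -(@ge0_weight (fun y => `|f y| + s * f y)).
    + by apply: eq_integral => x _; congr EFin; ring.
    + by apply: measurable_funD => //; exact: measurable_funM.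
    + move=> y; rewrite -lerBlDr sub0r (le_trans (ler_norm _))//.
      by rewrite normrN normrM ler_piMl.
  - by apply: intgD => //; exact: intgZ.
  - by apply: intgD => //; exact: intgZ.
have := H 1; have := H 0; rewrite normr0 normr1 ler01 lexx.
move=> /(_ isT) + /(_ isT).
rewrite !RintgD ?RintgZ//; try exact: intgZ.
by rewrite !mul0r !addr0 !mul1r mulrDr => -> /addrI.
Qed.

End weight.

(** Adding the bound [c] makes the weight nonnegative and turns [kappa] into kappa + c; the
    contribution of [c] then cancels. *)
Lemma Rintg_weight_bounded (G : T -> R) (c kappa : R) (f : U -> R) :
  measurable_fun [set: T] G -> (forall x, `|G x| <= c) ->
  (forall C, measurable C ->
    \int[P]_x (G x * \1_C (Y x)) = kappa * \int[P]_x \1_C (Y x)) ->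
  measurable_fun [set: U] f -> intg (f \o Y) ->
  \int[P]_x (G x * f (Y x)) = kappa * \int[P]_x f (Y x).
Proof.
move=> mG Gc GY mf iF.
have iG : intg G by exact: intg_bounded Gc.
have iGc : intg (fun x => G x + c) by apply: intgD => //; exact: intg_cst.
have i1 C : measurable C -> intg (fun x => \1_C (Y x)).
  move=> mC; apply: (intg_bounded _ (c := 1)); first exact: measurable_indic_comp.
  by move=> x; rewrite indicE; case: (_ \in _); rewrite ?normr1 ?normr0.
have iG1 C : measurable C -> intg (fun x => G x * \1_C (Y x)).
  move=> mC; apply: (intg_bounded _ (c := c)).
    by apply: measurable_funM => //; exact: measurable_indic_comp.
  move=> x; rewrite indicE normrM; case: (_ \in _);
    rewrite ?normr1 ?normr0 ?mulr1//.
  by rewrite mulr0 (le_trans _ (Gc x)).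
have iGf : intg (fun x => G x * f (Y x)).
  apply: (intg_le _ (g := fun x => c * `|f (Y x)|)).
  - by apply: measurable_funM => //; exact: (measurableT_comp mf).
  - by move=> x; rewrite normrM ler_wpM2r.
  - by apply: intgZ; exact: (integrable_norm iF).
have G0 x : 0 <= G x + c by rewrite -lerBlDr sub0r lerNl (le_trans (ler_norm _))//
  normrN.
have := @Rintg_weight (fun x => G x + c) (kappa + c) G0 iGc _ f mf iF.
under eq_Rintegral do rewrite mulrDl.
rewrite RintgD//; last exact: intgZ.
rewrite RintgZ// mulrDl => H; apply: (addIr (c * \int[P]_x f (Y x)));
  apply: H => C mC.
under eq_Rintegral do rewrite mulrDl.
by rewrite RintgD ?RintgZ ?GY ?mulrDl//; [exact: i1|exact: iG1|apply: intgZ;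
  exact: i1].
Qed.

End WeightedExpectation.

Section IndependentSums.
Context d1 d2 (T : measurableType d1) (U : measurableType d2) (R : realType)
  (P : probability T R) (n : nat) (X : 'I_n -> {RV P >-> U}).
Local Notation intg f := (P.-integrable [set: T] (EFin \o f)).
Hypothesis indepX : mutually_independent X.

Let mi (i : 'I_n) (C : set U) : measurable C -> measurable_fun [set: T] (fun x =>
  \1_C (X i x) : R).
Proof. exact: measurable_indic_comp. Qed.

Let i1 (i : 'I_n) C : measurable C -> intg (fun x => \1_C (X i x)).
Proof.
move=> mC; apply: (intg_bounded _ (c := 1)); first exact: mi.
by move=> x; rewrite indicE; case: (_ \in _); rewrite ?normr1 ?normr0.
Qed.

Lemma prod_indicE (I : finType) (A : I -> bool) (D : I -> set U) (y : I -> U) :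
  \prod_(i | A i) \1_(D i) (y i) = ([forall i, A i ==> (y i \in D i)])%:R :> R.
Proof.
case: (boolP [forall i, _]) => [/forallP H|].
  by rewrite big1// => i Ai; have := H i; rewrite Ai/= => yi; rewrite indicE yi.
rewrite negb_forall => /existsP[i]; rewrite negb_imply => /andP[Ai /negbTE yi].
by rewrite (bigD1 i)//= indicE yi mul0r.
Qed.

Lemma Rintg_prod_indic (B : 'I_n -> set U) : (forall i, measurable (B i)) ->
  \int[P]_x (\prod_i \1_(B i) (X i x)) = \prod_i \int[P]_x \1_(B i) (X i x).
Proof.
move=> mB.
have mXB i : measurable (X i @^-1` B i).
  by rewrite -[X in measurable X]setTI; exact: measurable_funP.
have pE i : \int[P]_x \1_(B i) (X i x) = fine (P (X i @^-1` B i)).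
  rewrite /Rintegral; congr fine.
  rewrite (_ : (fun x => _) = fun x => (\1_(X i @^-1` B i) x)%:E)//.
  by rewrite integral_indic ?setIT.
under [RHS]eq_bigr do rewrite pE.
have := indepX [set: 'I_n]%SET mB.
set A := \bigcap_(i in _) _ => PA.
have mA : measurable A.
  by apply: fin_bigcap_measurable => // i _; exact: mXB.
rewrite (_ : \int[P]_x _ = fine (P A)); last first.
  rewrite /Rintegral; congr fine.
  rewrite -[in RHS](setIT A) -integral_indic//; apply: eq_integral => x _.
  rewrite (prod_indicE xpredT B (fun i => X i x)) indicE; congr (_%:R%:E);
    congr nat_of_bool.
  apply/forallP/idP => [H|].
    by rewrite inE => i _ /=; have := H i; rewrite inE.
  by rewrite inE => H i; apply/implyP => _; rewrite inE; apply: H; rewrite /= inE.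
rewrite PA; apply: EFin_inj; rewrite fineK; last first.
  by rewrite -PA fin_num_measure.
rewrite -prodEFin big_mkcond/=; apply: eq_bigr => i _.
by rewrite inE fineK// fin_num_measure.
Qed.

(* This holds when [H] is a function of [X_0, ..., X_(k-1)], but it only mentions
   the events of the remaining variables, which makes it inductive in [k]. *)
Definition indep_after (k : nat) (H : T -> R) : Prop :=
  forall B : 'I_n -> set U, (forall i, measurable (B i)) ->
  \int[P]_x (H x * \prod_(i < n | (k <= i)%N) \1_(B i) (X i x)) =
  (\int[P]_x H x) * \prod_(i < n | (k <= i)%N) \int[P]_x \1_(B i) (X i x).

Let prod1 (k : nat) (B : 'I_n -> set U) x :
  0 <= (\prod_(i < n | (k <= i)%N) \1_(B i) (X i x) : R) <= 1.
Proof. by rewrite (prod_indicE (fun i : 'I_n => k <= i)%N B (fun i => X i x));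
  case: [forall _, _]; rewrite ?lexx ?ler01. Qed.

Let mprod (k : nat) (B : 'I_n -> set U) : (forall i, measurable (B i)) ->
  measurable_fun [set: T] (fun x => \prod_(i < n |
    (k <= i)%N) \1_(B i) (X i x) : R).
Proof.
move=> mB; rewrite (_ : (fun x => _) = fun x =>
    \prod_(i < n) if (k <= i)%N then \1_(B i) (X i x) else 1 : R); last first.
  by apply/funext => x; exact: big_mkcond.
by apply: measurable_prod => i _; case: (k <= i)%N => //; exact: mi.
Qed.

Let bprod (H : T -> R) c k B x : `|H x| <= c ->
  `|H x * \prod_(i < n | (k <= i)%N) \1_(B i) (X i x)| <= c.
Proof.
move=> Hc; rewrite normrM (le_trans _ Hc)// ler_piMr//.
by have /andP[? ?] := prod1 k B x; rewrite ger0_norm.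
Qed.

Section step.
Variables (k : nat) (j : 'I_n) (jk : j = k :> nat).
Variables (f : U -> R) (c' : R).
Hypotheses (mf : measurable_fun [set: U] f) (fc : forall y, `|f y| <= c').
Variables (H : T -> R) (c : R).
Hypotheses (mH : measurable_fun [set: T] H) (Hc : forall x, `|H x| <= c).
Hypothesis IH : indep_after k H.

Let weight B : (forall i, measurable (B i)) ->
  \int[P]_x (H x * \prod_(i < n | (k < i)%N) \1_(B i) (X i x) * f (X j x)) =
  ((\int[P]_x H x) * \prod_(i < n | (k < i)%N) \int[P]_x \1_(B i) (X i x)) *
   \int[P]_x f (X j x).
Proof.
move=> mB.
apply: (@Rintg_weight_bounded _ _ _ _ _ _ (X j)
  (fun x => H x * \prod_(i < n | (k < i)%N) \1_(B i) (X i x)) c _ f) => //.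
- by apply: measurable_funM => //; exact: mprod.
- by move=> x; exact: bprod.
(* Putting [C] in slot [j] turns the hypothesis on [H] at index [k] into the factorization that
   separates an event of [X j] from the later ones. *)
- move=> C mC; pose B' i := if i == j then C else B i.
  have mB' i : measurable (B' i) by rewrite /B'; case: ifP.
  have kE (i : 'I_n) : (k <= i)%N && (i != j) = (k < i)%N.
    by rewrite ltn_neqAle andbC -jk eq_sym.
  have B'j : B' j = C by rewrite /B' eqxx.
  have := IH mB'.
  rewrite (bigD1 j) ?jk//= B'j.
  rewrite (eq_bigl _ _ kE) => /esym IH'.
  have {}IH' : \int[P]_x (H x * \prod_(i < n |
    (k < i)%N) \1_(B i) (X i x) * \1_C (X j x)) =
    (\int[P]_x H x) * ((\int[P]_x \1_C (X j x)) * \prod_(i < n |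
      (k < i)%N) \int[P]_x \1_(B' i) (X i x)).
    rewrite IH'; apply: eq_Rintegral => x _.
    rewrite [in RHS](bigD1 j) ?jk//= B'j (eq_bigl _ _ kE) -mulrA [X in _ * X =
      _]mulrC.
    congr (_ * (_ * _)); apply: eq_bigr => i; rewrite /B'.
    by case: eqP => // ->; rewrite jk ltnn.
  rewrite IH' mulrCA mulrC; congr (_ * _ * _); apply: eq_bigr => i.
  by rewrite /B'; case: eqP => // ->; rewrite jk ltnn.
- by apply: (intg_bounded _ (c := c')) => [|x];
    [exact: (measurableT_comp mf)|exact: fc].
Qed.

Lemma Rintg_indep_after : \int[P]_x (H x * f (X j x)) = (\int[P]_x H x) * \int[P]_x
  f (X j x).
Proof.
have := @weight (fun _ : 'I_n => [set: U]) (fun _ => measurableT).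
have prT x : \prod_(i < n | (k < i)%N) \1_[set: U] (X i x) = 1 :> R.
  by rewrite big1// => i _; rewrite indicT.
under eq_Rintegral do rewrite prT mulr1.
rewrite [X in _ * X * _]big1 ?mulr1// => i _.
by under eq_Rintegral do rewrite indicT; exact: Rintg_cst.
Qed.

Lemma indep_afterS : indep_after k.+1 (fun x => H x * f (X j x)).
Proof.
move=> B mB; rewrite Rintg_indep_after.
under eq_Rintegral do rewrite mulrAC.
by rewrite weight// mulrAC.
Qed.

End step.

(** Needed because the addition formulas express cos and sin of a sum as combinations of two
    products. *)
Lemma indep_afterD k s (H1 H2 : T -> R) c :
  measurable_fun [set: T] H1 -> measurable_fun [set: T] H2 ->
  (forall x, `|H1 x| <= c) -> (forall x, `|H2 x| <= c) ->
  indep_after k H1 -> indep_after k H2 -> indep_after k (fun x => H1 x + s * H2 x).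
Proof.
move=> mH1 mH2 b1 b2 I1 I2 B mB.
have iH1 : intg H1 by exact: intg_bounded b1.
have iH2 : intg H2 by exact: intg_bounded b2.
have ip1 : intg (fun x => H1 x * \prod_(i < n | (k <= i)%N) \1_(B i) (X i x)).
  apply: (intg_bounded _ (c := c)) => [|x]; last exact: bprod.
  by apply: measurable_funM => //; exact: mprod.
have ip2 : intg (fun x => H2 x * \prod_(i < n | (k <= i)%N) \1_(B i) (X i x)).
  apply: (intg_bounded _ (c := c)) => [|x]; last exact: bprod.
  by apply: measurable_funM => //; exact: mprod.
under eq_Rintegral do rewrite mulrDl -mulrA.
rewrite (RintgD ip1 (intgZ s ip2)) (RintgD iH1 (intgZ s iH2)).
by rewrite (RintgZ s ip2) (RintgZ s iH2) (I1 _ mB) (I2 _ mB) mulrDl mulrA.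
Qed.

Section characteristic_function.
Variables (g : U -> R) (C S : R).
Hypothesis mg : measurable_fun [set: U] g.
Hypotheses (gC : forall i, \int[P]_x cos (g (X i x)) = C)
           (gS : forall i, \int[P]_x sin (g (X i x)) = S).

Let Y (k : nat) x := \sum_(i < n | (i < k)%N) g (X i x).

Let mY k : measurable_fun [set: T] (Y k).
Proof.
rewrite /Y (_ : (fun x => _) = fun x =>
    \sum_(i < n) if (i < k)%N then g (X i x) else 0); last first.
  by apply/funext => x; exact: big_mkcond.
apply: measurable_sum => i; case: (i < k)%N => //.
exact: (measurableT_comp mg).
Qed.

(** Multiplicativity of characteristic functions, in modulus. The induction step is the addition
    formulas followed by (C^2 + S^2) (C'^2 + S'^2) = (C C' - S S')^2 + (S C' + C S')^2; independence
    from the later variables has to be carried along. *)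
Lemma char_sum : (\int[P]_x cos (\sum_i g (X i x))) ^+ 2 +
  (\int[P]_x sin (\sum_i g (X i x))) ^+ 2 = (C ^+ 2 + S ^+ 2) ^+ n.
Proof.
have mc k := measurable_cos_comp (mY k).
have ms k := measurable_sin_comp (mY k).
have bc k x : `|cos (Y k x)| <= 1 by exact: cos_max.
have bs k x : `|sin (Y k x)| <= 1 by exact: sin_max.
have mcg := measurable_cos_comp mg.
have msg := measurable_sin_comp mg.
have bcg y : `|cos (g y)| <= 1 by exact: cos_max.
have bsg y : `|sin (g y)| <= 1 by exact: sin_max.
suff : forall k, (k <= n)%N -> [/\ indep_after k (fun x => cos (Y k x)),
    indep_after k (fun x => sin (Y k x)) &
    (\int[P]_x cos (Y k x)) ^+ 2 + (\int[P]_x sin (Y k x)) ^+ 2 = (C ^+ 2 + S ^+ 2)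
      ^+ k].
  move=> /(_ n (leqnn n))[_ _ <-].
  have YE x : Y n x = \sum_i g (X i x) by apply: eq_bigl => i; rewrite ltn_ord.
  by congr (_ ^+ 2 + _ ^+ 2); apply: eq_Rintegral => x _; rewrite YE.
elim=> [|k IH] kn.
  have Y0 x : Y 0 x = 0 by rewrite /Y big_pred0.
  have I0 (a : R) : indep_after 0 (fun=> a).
    move=> B mB; rewrite Rintg_cst RintgZ.
      by congr (_ * _); exact: Rintg_prod_indic.
    apply: (intg_bounded _ (c := 1)); first exact: mprod.
    by move=> x; have /andP[? ?] := prod1 0 B x; rewrite ger0_norm.
  have -> : (fun x => cos (Y 0 x)) = fun=> 1 by apply/funext => x; rewrite Y0 cos0.
  have -> : (fun x => sin (Y 0 x)) = fun=> 0 by apply/funext => x; rewrite Y0 sin0.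
  split; [exact: I0|exact: I0|].
  by rewrite !Rintg_cst expr1n expr0n addr0.
have [Ic Is IE] := IH (ltnW kn).
pose j := Ordinal kn.
have jk : j = k :> nat by [].
have YS x : Y k.+1 x = Y k x + g (X j x).
  rewrite /Y (bigD1 j)//= addrC; congr (_ + _); apply: eq_bigl => i.
  by rewrite ltnS -(inj_eq val_inj)/= [(i < k)%N]ltn_neqAle andbC.
have icc := indep_afterS jk mcg bcg (mc k) (bc k) Ic.
have ics := indep_afterS jk msg bsg (mc k) (bc k) Ic.
have isc := indep_afterS jk mcg bcg (ms k) (bs k) Is.
have iss := indep_afterS jk msg bsg (ms k) (bs k) Is.
have Ecc := Rintg_indep_after jk mcg bcg (mc k) (bc k) Ic.
have Ecs := Rintg_indep_after jk msg bsg (mc k) (bc k) Ic.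
have Esc := Rintg_indep_after jk mcg bcg (ms k) (bs k) Is.
have Ess := Rintg_indep_after jk msg bsg (ms k) (bs k) Is.
have mgX (h : U -> R) : measurable_fun [set: U] h -> measurable_fun [set: T] (fun x
  => h (X j x)).
  by move=> mh; exact: (measurableT_comp mh).
have mM (h1 : T -> R) (h2 : U -> R) : measurable_fun [set: T] h1 -> measurable_fun
  [set: U] h2 ->
    measurable_fun [set: T] (fun x => h1 x * h2 (X j x)).
  by move=> m1 m2; apply: measurable_funM => //; exact: mgX.
have b1 (a b : R) : `|a| <= 1 -> `|b| <= 1 -> `|a * b| <= 1.
  by move=> a1 b1; rewrite normrM mulr_ile1.
have cosS x : cos (Y k.+1 x) = cos (Y k x) * cos (g (X j x)) + -1 * (sin (Y k x) *
  sin (g (X j x))).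
  by rewrite YS cosD mulN1r.
have sinS x : sin (Y k.+1 x) = sin (Y k x) * cos (g (X j x)) + 1 * (cos (Y k x) *
  sin (g (X j x))).
  by rewrite YS sinD mul1r.
have iM (h1 : T -> R) (h2 : U -> R) : measurable_fun [set: T] h1 -> measurable_fun
  [set: U] h2 ->
    (forall x, `|h1 x| <= 1) -> (forall y, `|h2 y|
      <= 1) -> intg (fun x => h1 x * h2 (X j x)).
  by move=> m1 m2 bb1 bb2; apply: (intg_bounded _ (c := 1)) => [|x];
    [exact: mM|exact: b1].
have -> : (fun x => cos (Y k.+1 x)) = fun x => cos (Y k x) * cos (g (X j x)) + -1 *
  (sin (Y k x) * sin (g (X j x))).
  exact/funext.
have -> : (fun x => sin (Y k.+1 x)) = fun x => sin (Y k x) * cos (g (X j x)) + 1 *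
  (cos (Y k x) * sin (g (X j x))).
  exact/funext.
split.
- apply: (indep_afterD _ (mM _ _ (mc k) mcg) (mM _ _ (ms k) msg) _ _ icc iss).
    by move=> x; exact: b1.
  by move=> x; exact: b1.
- apply: (indep_afterD _ (mM _ _ (ms k) mcg) (mM _ _ (mc k) msg) _ _ isc ics).
    by move=> x; exact: b1.
  by move=> x; exact: b1.
have jcc := iM _ _ (mc k) mcg (bc k) bcg.
have jss := iM _ _ (ms k) msg (bs k) bsg.
have jsc := iM _ _ (ms k) mcg (bs k) bcg.
have jcs := iM _ _ (mc k) msg (bc k) bsg.
rewrite (RintgD jcc (intgZ _ jss)) (RintgD jsc (intgZ _ jcs)) (RintgZ _ jss) (RintgZ
  _ jcs).
rewrite Ecc Ess Esc Ecs gC gS [RHS]exprS -IE; ring.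
Qed.

End characteristic_function.

End IndependentSums.

Section IndependentProduct.
Context d1 d2 (T : measurableType d1) (U : measurableType d2) (R : realType)
  (P : probability T R) (n : nat) (X : 'I_n -> {RV P >-> U}).
Local Notation intg f := (P.-integrable [set: T] (EFin \o f)).
Hypothesis indepX : mutually_independent X.
Variables (i j : 'I_n) (ij : i != j).

Let mi (l : 'I_n) (C : set U) : measurable C -> measurable_fun [set: T] (fun x =>
  \1_C (X l x) : R).
Proof. exact: measurable_indic_comp. Qed.

Let b1 (l : 'I_n) (C : set U) x : `|\1_C (X l x) : R| <= 1.
Proof. by rewrite indicE; case: (_ \in _); rewrite ?normr1 ?normr0. Qed.

Let indic2 C D : measurable C -> measurable D ->
  \int[P]_x (\1_C (X i x) * \1_D (X j x)) =
  (\int[P]_x \1_C (X i x)) * \int[P]_x \1_D (X j x).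
Proof.
move=> mC mD; pose B l := if l == i then C else if l == j then D else setT.
have mB l : measurable (B l) by rewrite /B; case: ifP => // _; case: ifP.
have Bi : B i = C by rewrite /B eqxx.
have Bj : B j = D by rewrite /B eq_sym (negbTE ij) eqxx.
have Bl l : (l != i) && (l != j) -> B l = setT.
  by rewrite /B => /andP[/negbTE -> /negbTE ->].
have := Rintg_prod_indic indepX mB.
rewrite (bigD1 i)//= (bigD1 j) 1?eq_sym//= Bi Bj [X in _ = _ * (_ * X)]big1 ?mulr1;
  last first.
  by move=> l /Bl ->; under eq_Rintegral do rewrite indicT; exact: Rintg_cst.
move=> <-; apply: eq_Rintegral => x _.
rewrite (bigD1 i)//= (bigD1 j) 1?eq_sym//= Bi Bj [X in _ = _ * (_ * X)]big1
  ?mulr1//.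
by move=> l /Bl ->; rewrite indicT.
Qed.

(** The factorization is extended one variable at a time: here an indicator of [X i] is the weight
    and [b] the function of [X j]; afterwards [b] becomes the weight for functions of [X i]. *)
Let indic_mul (b : U -> R) C : measurable_fun [set: U] b -> intg (fun x => b (X j
  x)) ->
  measurable C ->
  \int[P]_x (b (X j x) * \1_C (X i x)) =
  (\int[P]_x b (X j x)) * \int[P]_x \1_C (X i x).
Proof.
move=> mb ib mC; rewrite mulrC; under eq_Rintegral do rewrite mulrC.
apply: (@Rintg_weight_bounded _ _ _ _ _ _ (X j) (fun x => \1_C (X i x)) 1) => //.
- exact: mi.
- by move=> D mD; exact: indic2.
Qed.

Variables a b : U -> R.
Hypotheses (ma : measurable_fun [set: U] a) (mb : measurable_fun [set: U] b).
Hypotheses (ia : intg (fun x => a (X i x))) (ib : intg (fun x => b (X j x))).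

Let mnb : measurable_fun [set: U] (fun y => `|b y|).
Proof. exact: measurableT_comp. Qed.

Let inb : intg (fun x => `|b (X j x)|).
Proof. exact: (integrable_norm ib). Qed.

Lemma intg_indep_mul : intg (fun x => a (X i x) * b (X j x)).
Proof.
have := @intg_weight _ _ _ _ _ _ (X i) (fun x => `|b (X j x)|) (\int[P]_x `|b (X j
  x)|)
  (fun x => normr_ge0 _) inb (fun C mC => indic_mul mnb inb mC) a ma ia.
apply: le_integrable => //.
  apply/measurable_EFinP; apply: measurable_funM.
    exact: (measurableT_comp ma).
  exact: (measurableT_comp mb).
by move=> x _ /=; rewrite lee_fin !normrM normr_id mulrC.
Qed.

Lemma Rintg_indep_mul : \int[P]_x (a (X i x) * b (X j x)) =
  (\int[P]_x a (X i x)) * \int[P]_x b (X j x).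
Proof.
(* Weights must be nonnegative and integrable: |b| + b and |b| are used, and their difference gives
   [b]. *)
have mb2 : measurable_fun [set: U] (fun y => `|b y|
  + b y) by exact: measurable_funD.
have ib2 : intg (fun x => `|b (X j x)| + b (X j x)) by exact: intgD.
have b20 x : 0 <= `|b (X j x)| + b (X j x).
  by rewrite -lerBlDr sub0r (le_trans (ler_norm _))// normrN.
have := @Rintg_weight _ _ _ _ _ _ (X i) (fun x => `|b (X j x)| + b (X j x)) _
  b20 ib2 (fun C mC => indic_mul mb2 ib2 mC) a ma ia.
have := @Rintg_weight _ _ _ _ _ _ (X i) (fun x => `|b (X j x)|) _
  (fun x => normr_ge0 _) inb (fun C mC => indic_mul mnb inb mC) a ma ia.
have ina := @intg_weight _ _ _ _ _ _ (X i) (fun x => `|b (X j x)|) _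
  (fun x => normr_ge0 _) inb (fun C mC => indic_mul mnb inb mC) a ma ia.
have iab := intg_indep_mul.
rewrite (RintgD inb ib) mulrDl => E1.
under eq_Rintegral do rewrite mulrDl [X in _ + X]mulrC.
by rewrite (RintgD ina iab) E1 => /addrI ->; rewrite mulrC.
Qed.

End IndependentProduct.

(** * Laplace transform of the squared norm of a sample mean *)

Section IdenticalLaws.
Context d1 d2 (T : measurableType d1) (U : measurableType d2) (R : realType)
  (P : probability T R) (X Y : {RV P >-> U}).
Local Notation intg f := (P.-integrable [set: T] (EFin \o f)).
Hypothesis XY : forall B, measurable B -> distribution P X B = distribution P Y B.

Lemma ge0_integral_same_law (f : U -> \bar R) : measurable_fun [set: U] f ->
  (forall y, 0 <= f y)%E -> (\int[P]_x f (X x) = \int[P]_x f (Y x))%E.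
Proof.
move=> mf f0; rewrite -(ge0_integral_distribution X mf f0)
  -(ge0_integral_distribution Y mf f0).
by apply: eq_measure_integral => B mB _; exact: XY.
Qed.

Lemma intg_same_law (f : U -> R) : measurable_fun [set: U] f ->
  intg (fun x => f (Y x)) -> intg (fun x => f (X x)).
Proof.
move=> mf /integrableP[_ iY]; apply/integrableP; split.
  by apply/measurable_EFinP; exact: (measurableT_comp mf).
rewrite (_ : (fun x => _) = fun x => (`|(f (X x))%:E|)%E)//.
rewrite (@ge0_integral_same_law (fun y => (`|(f y)%:E|)%E))//.
by apply: measurableT_comp => //; exact/measurable_EFinP.
Qed.

Lemma Rintg_same_law (f : U -> R) : measurable_fun [set: U] f ->
  intg (fun x => f (Y x)) -> \int[P]_x f (X x) = \int[P]_x f (Y x).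
Proof.
move=> mf iY; have iX := intg_same_law mf iY.
have mfe : measurable_fun [set: U] (EFin \o f) by exact/measurable_EFinP.
rewrite /Rintegral; congr fine.
rewrite -[LHS](integral_distribution mfe iX) -[RHS](integral_distribution mfe iY).
by apply: eq_measure_integral => B mB _; exact: XY.
Qed.

End IdenticalLaws.

Section SampleMeanLowerTail.
Context d1 d2 (T : measurableType d1) (U : measurableType d2) (R : realType)
  (P : probability T R) (n : nat) (X0 : {RV P >-> U}) (X : 'I_n -> {RV P >-> U}).
Local Notation intg f := (P.-integrable [set: T] (EFin \o f)).
Hypothesis n0 : (0 < n)%N.
Hypothesis indepX : mutually_independent X.
Hypothesis sameX : forall i B,
  measurable B -> distribution P (X i) B = distribution P X0 B.
Variables (m : nat) (a : 'I_m -> U -> R).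
Hypothesis ma : forall k, measurable_fun [set: U] (a k).
Hypothesis a4 : forall k, intg (fun x => a k (X0 x) ^+ 4).
Hypothesis a0 : forall k, \int[P]_x a k (X0 x) = 0.

Local Notation av u := (fun k => a k u).

Let maX k (Z : {RV P >-> U}) : measurable_fun [set: T] (fun x => a k (Z x)).
Proof. exact: (measurableT_comp (ma k)). Qed.

Let a11 k l : intg (fun x => a k (X0 x) * a l (X0 x)).
Proof.
apply: (@intg_le _ _ _ P _ (fun x => (1 + a k (X0 x) ^+ 4) + a l (X0 x) ^+ 4)).
- by apply: measurable_funM; exact: maX.
- move=> x; move: (a k (X0 x)) (a l (X0 x)) => y z.
  rewrite ler_norml; apply/andP; split;
    have := sqr_ge0 (y + z); have := sqr_ge0 (y - z);
    have := sqr_ge0 (y ^+ 2 - 1); have := sqr_ge0 (z ^+ 2 - 1);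
    have := sqr_ge0 (y ^+ 2); have := sqr_ge0 (z ^+ 2); lra.
- by apply: intgD => //; apply: intgD => //; exact: intg_cst.
Qed.

Let a1 k : intg (fun x => a k (X0 x)).
Proof.
apply: (@intg_le _ _ _ P _ (fun x => 1 + a k (X0 x) * a k (X0 x))) => //.
- move=> x; move: (a k (X0 x)) => y.
  by rewrite ler_norml; apply/andP; split; have := sqr_ge0 (y - 1); have :=
    sqr_ge0 (y + 1); lra.
- by apply: intgD => //; exact: intg_cst.
Qed.

(** The matrix Q of the overview, in coordinates. *)
Definition second_moment (k l : 'I_m) : R := \int[P]_x (a k (X0 x) * a l (X0 x)).

Definition sample_mean (x : T) (k : 'I_m) : R := n%:R^-1 * \sum_i a k (X i x).

Lemma second_moment_sym k l : second_moment k l = second_moment l k.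
Proof. by apply: eq_Rintegral => x _; rewrite mulrC. Qed.

Let dot_sqrE (v w : 'I_m -> R) : dotf v w ^+ 2 = \sum_k \sum_l v k * v l * (w k * w
  l).
Proof.
rewrite expr2 {1}/dotf mulr_suml; apply: eq_bigr => k _.
by rewrite /dotf mulr_sumr; apply: eq_bigr => l _; ring.
Qed.

Lemma Rintg_dot_sqr (v : 'I_m -> R) :
  \int[P]_x (dotf v (av (X0 x)) ^+ 2) = qf second_moment v.
Proof.
under eq_Rintegral do rewrite dot_sqrE.
rewrite Rintg_sum; last by move=> k; apply: intg_sum => l; exact: intgZ.
apply: eq_bigr => k _; rewrite Rintg_sum; last by move=> l; exact: intgZ.
by apply: eq_bigr => l _; rewrite RintgZ// /second_moment; ring.
Qed.

Lemma second_moment_ge0 (v : 'I_m -> R) : 0 <= qf second_moment v.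
Proof. by rewrite -Rintg_dot_sqr; apply: Rintegral_ge0 => x _; exact: sqr_ge0. Qed.

Let mdot (v : 'I_m -> R) : measurable_fun [set: U] (fun u => dotf v (av u)).
Proof. by apply: measurable_sum => k; exact: measurable_funM. Qed.

Let aX k i : intg (fun x => a k (X i x)).
Proof. exact: (intg_same_law (sameX i) (ma k)). Qed.

Let aX0 k i : \int[P]_x a k (X i x) = 0.
Proof. by rewrite (Rintg_same_law (sameX i) (ma k)). Qed.

Let maa k : measurable_fun [set: U] (fun u => a k u * a k u).
Proof. exact: measurable_funM. Qed.

Let aXX k i j : intg (fun x => a k (X i x) * a k (X j x)).
Proof.
have [<-|ij] := eqVneq i j; last exact: (intg_indep_mul indepX ij).
exact: (intg_same_law (sameX i) (maa k) (a11 k k)).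
Qed.

Let Rintg_aXX k i j : \int[P]_x (a k (X i x) * a k (X j x)) =
  (i == j)%:R * second_moment k k.
Proof.
have [<-|ij] := eqVneq i j.
  by rewrite mul1r (Rintg_same_law (sameX i) (maa k) (a11 k k)).
by rewrite (Rintg_indep_mul indepX ij)// aX0 !mul0r.
Qed.

Let sqr_sample_meanE x : dotf (sample_mean x) (sample_mean x) =
  \sum_k \sum_i \sum_j n%:R^-1 ^+ 2 * (a k (X i x) * a k (X j x)).
Proof.
apply: eq_bigr => k _; rewrite /sample_mean mulrACA -expr2 mulr_suml mulr_sumr.
by apply: eq_bigr => i _; rewrite [_ * \sum_i _]mulr_sumr mulr_sumr.
Qed.

Let intg_dot4 (v : 'I_m -> R) : intg (fun x => dotf v (av (X0 x)) ^+ 4).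
Proof.
apply: intg4_sum => k; first by apply: measurable_funM => //; exact: maX.
rewrite (_ : (fun x => _) = fun x => v k ^+ 4 * a k (X0 x) ^+ 4);
  first exact: intgZ.
by apply/funext => x; rewrite exprMn.
Qed.

Lemma intg_dot2 (v : 'I_m -> R) : intg (fun x => dotf v (av (X0 x)) ^+ 2).
Proof.
rewrite (_ : (fun x => _) = fun x =>
    \sum_k \sum_l v k * v l * (a k (X0 x) * a l (X0 x))); last first.
  by apply/funext => x; exact: dot_sqrE.
by apply: intg_sum => k; apply: intg_sum => l; exact: intgZ.
Qed.

Lemma intg_dot (v : 'I_m -> R) : intg (fun x => dotf v (av (X0 x))).
Proof. by apply: intg_sum => k; exact: intgZ. Qed.

Lemma Rintg_dot (v : 'I_m -> R) : \int[P]_x dotf v (av (X0 x)) = 0.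
Proof.
rewrite Rintg_sum => [|k]; last exact: intgZ.
by rewrite big1// => k _; rewrite RintgZ// a0 mulr0.
Qed.

Lemma intg_sqr_sample_mean : intg (fun x => dotf (sample_mean x) (sample_mean x)).
Proof.
rewrite (_ : (fun x => _) = fun x =>
    \sum_k \sum_i \sum_j n%:R^-1 ^+ 2 * (a k (X i x) * a k (X j x))); last first.
  by apply/funext => x; exact: sqr_sample_meanE.
by apply: intg_sum => k; apply: intg_sum => i; apply: intg_sum => j; exact: intgZ.
Qed.

Lemma Rintg_sqr_sample_mean : \int[P]_x dotf (sample_mean x) (sample_mean x) =
  (\sum_k second_moment k k) / n%:R.
Proof.
under eq_Rintegral do rewrite sqr_sample_meanE.
rewrite Rintg_sum; last first.
  by move=> k; apply: intg_sum => i; apply: intg_sum => j; exact: intgZ.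
rewrite mulr_suml; apply: eq_bigr => k _.
rewrite Rintg_sum; last by move=> i; apply: intg_sum => j; exact: intgZ.
transitivity (\sum_(i < n) n%:R^-1 ^+ 2 * second_moment k k).
  apply: eq_bigr => i _; rewrite Rintg_sum; last by move=> j; exact: intgZ.
  rewrite (bigD1 i)//= big1 ?addr0 => [|j ji].
    by rewrite RintgZ// Rintg_aXX eqxx mul1r.
  by rewrite RintgZ// Rintg_aXX eq_sym (negbTE ji) mul0r mulr0.
rewrite sumr_const card_ord -mulr_natl; field.
by rewrite pnatr_eq0 -lt0n.
Qed.

Section moment_generating_function.
(** In the application [K] is Sigma (x) Sigma and [kappa] is |Sigma|^2, so that [qf K v] is
    |Sigma^(1/2) V Sigma^(1/2)|^2 for the matrix V with coordinates v. *)
Variables (K : 'I_m -> 'I_m -> R) (alpha kappa : R).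
Hypothesis symK : forall k l, K k l = K l k.
Hypotheses (K0 : forall v, 0 <= qf K v)
  (Kkappa : forall v, qf K v <= kappa * dotf v v).
Hypotheses (alpha0 : 0 < alpha) (kappa0 : 0 < kappa).
Hypothesis fourth_moment : forall v : 'I_m -> R,
  \int[P]_x (dotf v (av (X0 x)) ^+ 4) <= alpha ^+ 2 * qf K v ^+ 2.

Local Notation tau := (\sum_k K k k).
Local Notation trQ := (\sum_k second_moment k k).
Local Notation frobQ := (\sum_k \sum_l second_moment k l ^+ 2).

Let qf_delta (H : 'I_m -> 'I_m -> R) k : qf H (fun l => (l == k)%:R) = H k k.
Proof.
rewrite /qf (bigD1 k)//= [X in _ + X]big1 ?addr0 => [|l lk]; last first.
  by rewrite big1// => j _; rewrite (negbTE lk) mulr0 mul0r.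
rewrite (bigD1 k)//= eqxx !mulr1 big1 ?addr0// => l lk.
by rewrite (negbTE lk) mulr0.
Qed.

(** Jensen's inequality (E Z^2)^2 <= E Z^4 for Z = <v, a>: as quadratic forms, Q <= alpha K. *)
Lemma qf_second_moment_le (v : 'I_m -> R) : qf second_moment v <= alpha * qf K v.
Proof.
have mv : measurable_fun [set: T] (fun x => dotf v (av (X0 x))) by exact:
  (measurableT_comp (mdot v)).
have H := sqr_m2_le mv (intg_dot4 v) (Rintg_dot v).
rewrite Rintg_dot_sqr in H.
rewrite -ler_sqr ?nnegrE ?second_moment_ge0 ?mulr_ge0 ?(ltW alpha0)//.
by rewrite exprMn (le_trans H).
Qed.

Lemma trQ_le : trQ <= alpha * tau.
Proof.
by rewrite mulr_sumr ler_sum// => k _; rewrite -!qf_delta qf_second_moment_le.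
Qed.

Lemma intg_qf (H : 'I_m -> 'I_m -> R) : intg (fun x => qf H (av (X0 x))).
Proof.
rewrite (_ : (fun x => _) = fun x => \sum_k \sum_l H k l * (a k (X0 x) * a l (X0
  x))).
  by apply: intg_sum => k; apply: intg_sum => l; exact: intgZ.
by apply/funext => x; apply: eq_bigr => k _; apply: eq_bigr => l _; rewrite mulrA.
Qed.

Lemma Rintg_qf (H : 'I_m -> 'I_m -> R) :
  \int[P]_x qf H (av (X0 x)) = \sum_k \sum_l H k l * second_moment k l.
Proof.
rewrite Rintg_sum => [|k]; last first.
  apply: intg_sum => l; rewrite (_ : (fun x => _) = fun x => H k l * (a k (X0 x) * a
    l (X0 x))).
    exact: intgZ.
  by apply/funext => x; rewrite mulrA.
apply: eq_bigr => k _; under eq_Rintegral do under eq_bigr do rewrite -mulrA.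
rewrite Rintg_sum => [|l]; last exact: intgZ.
by apply: eq_bigr => l _; rewrite RintgZ.
Qed.

(** Since Q = E a a^T, its squared Frobenius norm is E <a, Q a>, to which Q <= alpha K applies
    pointwise. *)
Lemma frobQ_le : frobQ <= alpha * \int[P]_x qf K (av (X0 x)).
Proof.
have -> : frobQ = \int[P]_x qf second_moment (av (X0 x)).
  by rewrite Rintg_qf; apply: eq_bigr => k _; apply: eq_bigr => l _; rewrite expr2.
rewrite -RintgZ; last exact: intg_qf.
apply: le_Rintg => [||x]; [exact: intg_qf|apply: intgZ; exact: intg_qf|].
exact: qf_second_moment_le.
Qed.

Variable lambda : R.
Hypotheses (lambda0 : 0 <= lambda) (lambda_le : lambda <= n%:R / (4 * alpha *
  kappa)).

Let nR0 : 0 < n%:R :> R. Proof. by rewrite ltr0n. Qed.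

Let c : R := Num.sqrt (2 * lambda) / n%:R.

Let c2 : c ^+ 2 = 2 * lambda / n%:R ^+ 2.
Proof. by rewrite /c expr_div_n sqr_sqrtr// mulr_ge0. Qed.

Let phase (t : 'I_m -> R) (u : U) : R := c * dotf t (av u).

Let mphase t : measurable_fun [set: U] (phase t).
Proof. by apply: measurable_funM => //; exact: mdot. Qed.

Let sum_phase t x : \sum_i phase t (X i x) =
  dotf (fun k => Num.sqrt (2 * lambda) * sample_mean x k) t.
Proof.
rewrite /phase -mulr_sumr /dotf exchange_big/= mulr_sumr; apply: eq_bigr => k _.
by rewrite -mulr_sumr /c /sample_mean; ring.
Qed.

(** When [qf K t] <= 3 tau, the parameter a of the fourth-moment bound is at most 6 alpha lambda tau
    / n^2, and [E1] is exp (n a^2 / 6) at that value: the bound a^2 / 3 concerns |phi|^2, hence the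
    halving. [E2] and [H2] encode exp ((qf K t - 3 tau) / (4 kappa)), where 4 kappa is chosen to
    give [H2] >= - 1/2. *)
Let E1 := expR (6 * lambda ^+ 2 * alpha ^+ 2 * tau ^+ 2 / n%:R ^+ 3).
Let E2 := expR (- (3 * tau) / (4 * kappa)).
Let H1 k l := 2 * lambda / n%:R * second_moment k l.
Let H2 k l := - (2 * kappa)^-1 * K k l.

Let qfZ s (H : 'I_m -> 'I_m -> R) t : qf (fun k l => s * H k l) t = s * qf H t.
Proof.
rewrite /qf mulr_sumr; apply: eq_bigr => k _; rewrite mulr_sumr.
by apply: eq_bigr => l _; rewrite !mulrA.
Qed.

(* The second summand is at least [1] as soon as [3 * tau <= qf K t], where the
   trivial bound on the characteristic function suffices. *)
Let cos_sum_le t : \int[P]_x cos (\sum_i phase t (X i x)) <=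
  E1 * expR (- qf H1 t / 2) + E2 * expR (- qf H2 t / 2).
Proof.
set C := \int[P]_x cos (phase t (X0 x)).
set S := \int[P]_x sin (phase t (X0 x)).
have mcp := measurable_cos_comp (mphase t).
have msp := measurable_sin_comp (mphase t).
have mp0 : measurable_fun [set: T] (fun x => phase t (X0 x)) by exact:
  (measurableT_comp (mphase t)).
have HC i : \int[P]_x cos (phase t (X i x)) = C.
  exact: (Rintg_same_law (sameX i) mcp (intg_cos P mp0)).
have HS i : \int[P]_x sin (phase t (X i x)) = S.
  exact: (Rintg_same_law (sameX i) msp (intg_sin P mp0)).
have char := char_sum indepX (mphase t) HC HS.
have CS1 : C ^+ 2 + S ^+ 2 <= 1 by exact: char_sqr_le1.
have CS0 : 0 <= C ^+ 2 + S ^+ 2 by rewrite addr_ge0 ?sqr_ge0.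
set I := \int[P]_x cos _ in char *.
have I2 : I ^+ 2 <= (C ^+ 2 + S ^+ 2) ^+ n by rewrite -char lerDl sqr_ge0.
have tau0 : 0 <= tau by apply: sumr_ge0 => k _; rewrite -qf_delta.
have Le y : I ^+ 2 <= y ^+ 2 -> 0 <= y -> I <= y.
  move=> Iy y0; rewrite (le_trans (ler_norm I))//.
  by rewrite -ler_sqr ?nnegrE// real_normK// num_real.
have [Kt|Kt] := leP (qf K t) (3 * tau).
  apply: (@le_trans _ _ (E1 * expR (- qf H1 t / 2))); last first.
    by rewrite lerDl mulr_ge0// expR_ge0.
  apply: Le; last by rewrite mulr_ge0 ?expR_ge0.
  apply: (le_trans I2).
  have p4 : intg (fun x => phase t (X0 x) ^+ 4).
    rewrite (_ : (fun x => _) = fun x => c ^+ 4 * dotf t (av (X0 x)) ^+ 4).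
      exact: intgZ.
    by apply/funext => x; rewrite exprMn.
  have p0 : \int[P]_x phase t (X0 x) = 0.
    rewrite RintgZ ?Rintg_dot ?mulr0//; apply: intg_sum => k; exact: intgZ.
  have m4 : \int[P]_x (phase t (X0 x) ^+ 4) <= (alpha * c ^+ 2 * qf K t) ^+ 2.
    under eq_Rintegral do rewrite exprMn.
    rewrite RintgZ// (_ : (_ * _ * _) ^+ 2 = c ^+ 4 * (alpha ^+ 2 * qf K t ^+ 2));
      last by ring.
    by rewrite ler_wpM2l// (exprM c 2 2) sqr_ge0.
  have := char_sqr_le_expR mp0 p4 p0 _ m4.
  have ap0 : 0 <= alpha * c ^+ 2 * qf K t.
    by rewrite mulr_ge0// mulr_ge0 ?sqr_ge0// ltW.
  rewrite -/C -/S => /(_ ap0) CSe.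
  apply: (@le_trans _ _ (expR (- (c ^+ 2 * qf second_moment t) + (alpha * c ^+ 2 *
    qf K t) ^+ 2 / 3) ^+ n)).
    rewrite lerXn2r ?nnegrE ?expR_ge0// (le_trans CSe)// ler_expR lerD2r lerN2.
    under eq_Rintegral do rewrite exprMn.
    by rewrite RintgZ ?Rintg_dot_sqr//; exact: intg_dot2.
  rewrite /E1 -expRD -!expRM_natl ler_expR.
  rewrite /H1 qfZ c2.
  have k2 : qf K t ^+ 2 <= 9 * tau ^+ 2.
    rewrite (_ : 9 * _ = (3 * tau) ^+ 2); last by ring.
    by rewrite lerXn2r ?nnegrE ?mulr_ge0// K0.
  rewrite -subr_ge0 (_ : _ - _ = 4 / 3 * lambda ^+ 2 * alpha ^+ 2 / n%:R ^+ 3 * (9 *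
    tau ^+ 2 - qf K t ^+ 2)); last first.
    by field; rewrite gt_eqF.
  by rewrite mulr_ge0 ?subr_ge0// divr_ge0 ?exprn_ge0// mulr_ge0 ?sqr_ge0//
    mulr_ge0 ?sqr_ge0.
apply: (@le_trans _ _ 1).
  apply: Le => //; rewrite expr1n (le_trans I2)// exprn_ile1//.
apply: (@le_trans _ _ (E2 * expR (- qf H2 t / 2))); last first.
  by rewrite lerDr mulr_ge0// expR_ge0.
rewrite /E2 -expRD -[leLHS]expR0 ler_expR /H2 qfZ.
rewrite (_ : - (3 * tau) / (4 * kappa) + - (- (2 * kappa)^-1 * qf K t) / 2 =
  (qf K t - 3 * tau) / (4 * kappa)); last by field; rewrite gt_eqF.
by rewrite divr_ge0 ?subr_ge0 ?mulr_ge0 ?ltW.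
Qed.

Let v (x : T) (k : 'I_m) : R := Num.sqrt (2 * lambda) * sample_mean x k.

Let dot_vv x : - dotf (v x) (v x) / 2 = - lambda * dotf (sample_mean x) (sample_mean
  x).
Proof.
have -> : dotf (v x) (v x) = 2 * lambda * dotf (sample_mean x) (sample_mean x).
  rewrite -[in RHS](@sqr_sqrtr _ (2 * lambda)) ?mulr_ge0// /dotf mulr_sumr.
  by apply: eq_bigr => k _; rewrite /v; ring.
by field.
Qed.

Let msm k : measurable_fun [set: T] (fun x => sample_mean x k).
Proof. by apply: measurable_funM => //; apply: measurable_sum => i; exact: maX. Qed.

Let integral_gauss_vec_le :
  (\int[gauss_vec m]_t (1 + (E1 * expR (- qf H1 (tnth t) / 2) + E2 * expR (- qf H2
    (tnth t) / 2)))%:E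
   <= (1 + (E1 * expR (- (\sum_k H1 k k) / 2 + (\sum_k \sum_l H1 k l ^+ 2) / 4) +
      E2 * expR (- (\sum_k H2 k k))))%:E)%E.
Proof.
have mq (H : 'I_m -> 'I_m -> R) (b : R) : measurable_fun [set: m.-tuple R]
    (fun t => (b * expR (- qf H (tnth t) / 2))%:E).
  apply/measurable_EFinP; apply: measurable_funM => //;
    apply: measurableT_comp => //.
  apply: measurable_funM => //; apply: measurableT_comp => //.
  exact: measurable_qf.
have g1 : (gauss_vec m : measure _ R) [set: m.-tuple R] = 1%E by exact:
  probability_setT.
have E10 : 0 <= E1 by exact: expR_ge0.
have E20 : 0 <= E2 by exact: expR_ge0.
have p0 b H : 0 <= b -> forall t : m.-tuple R, [set: m.-tuple R] t ->
    (0 <= (b * expR (- qf H (tnth t) / 2))%:E)%E.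
  by move=> b0 t _; rewrite lee_fin mulr_ge0// expR_ge0.
under eq_integral do rewrite EFinD EFinD.
rewrite (@ge0_integralD _ _ _ _ _ measurableT (fun=> 1%E)) //; [|by move=> t tT;
  rewrite adde_ge0 ?p0|by apply: emeasurable_funD; exact: mq].
rewrite integral_cst// [X in (_ * X)%E]g1 mule1 EFinD leeD2l//.
rewrite (ge0_integralD _ measurableT (p0 _ _ E10) (mq _ _) (p0 _ _ E20) (mq _ _)).
have e0 H (t : m.-tuple R) : [set: m.-tuple R] t -> (0 <= (expR (- qf H (tnth t) /
  2))%:E)%E.
  by rewrite lee_fin expR_ge0.
have mq1 H : measurable_fun [set: m.-tuple R] (fun t => (expR (- qf H (tnth t) /
  2))%:E).
  by have := mq H 1; under eq_fun do rewrite mul1r.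
rewrite EFinD leeD//.
- under eq_integral do rewrite EFinM.
  rewrite (ge0_integralZl_EFin _ measurableT (@e0 H1) (mq1 H1) E10) EFinM
    lee_wpmul2l ?lee_fin//.
  apply: gauss_vec_exp_psd => [k l|x]; first by rewrite /H1 second_moment_sym.
  by rewrite /H1 qfZ mulr_ge0 ?second_moment_ge0// divr_ge0// mulr_ge0.
- under eq_integral do rewrite EFinM.
  rewrite (ge0_integralZl_EFin _ measurableT (@e0 H2) (mq1 H2) E20) EFinM
    lee_wpmul2l ?lee_fin//.
  have ik : 0 < (2 * kappa)^-1 by rewrite invr_gt0 mulr_gt0.
  apply: gauss_vec_exp_le_half => [k l|x|x]; first by rewrite /H2 symK.
    by rewrite /H2 qfZ mulNr oppr_le0 mulr_ge0// ltW.
  rewrite /H2 qfZ !mulNr lerN2.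
  have h := Kkappa x; rewrite -(ler_pM2l ik) in h; apply: (le_trans h).
  by rewrite le_eqVlt; apply/orP; left; apply/eqP; field; rewrite gt_eqF.
Qed.

Let mexpq (H : 'I_m -> 'I_m -> R) : measurable_fun [set: m.-tuple R]
  (fun t => expR (- qf H (tnth t) / 2)).
Proof.
apply: measurableT_comp => //.
apply: measurable_funM => //; apply: measurableT_comp => //.
exact: measurable_qf.
Qed.

(** The last factor adds two regimes: its exponential comes from typical Gaussian vectors, and its 1
    from the atypical ones, whose share is at most exp (- lambda tr Q / n) by the cap on
    [lambda]. *)
Theorem mgf_sqr_sample_mean :
  (\int[P]_x (expR (- lambda * dotf (sample_mean x) (sample_mean x)))%:E <=
   (expR (- lambda * (trQ / n%:R)) *
     (expR (lambda ^+ 2 * frobQ / n%:R ^+ 2 +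
        6 * lambda ^+ 2 * alpha ^+ 2 * tau ^+ 2 / n%:R ^+ 3) + 1))%:E)%E.
Proof.
(* Tonelli's theorem is applied to 1 + cos; the constant 1 is cancelled from both sides
   afterwards. *)
pose F (z : T * m.-tuple R) : \bar R := (1 + cos (dotf (v z.1) (tnth z.2)))%:E.
have mF : measurable_fun [set: T * m.-tuple R] F.
  apply/measurable_EFinP; apply: measurable_funD => //; apply: measurable_cos_comp.
  apply: measurable_sum => k; apply: measurable_funM.
    apply: measurable_funM => //.
    exact: (measurableT_comp (msm k)).
  exact: (measurableT_comp (measurable_tnth k)).
have F0 z : (0 <= F z)%E by rewrite lee_fin -lerBlDl sub0r cos_geN1.
have mE : measurable_fun [set: T] (fun x => (expR (- lambda * dotf (sample_mean x)
  (sample_mean x)))%:E).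
  apply/measurable_EFinP; apply: measurableT_comp => //;
    apply: measurable_funM => //.
  by apply: measurable_sum => k; exact: measurable_funM.
have := fubini_tonelli F mF F0 (m1 := P) (m2 := gauss_vec m).
rewrite [LHS](_ : _ = (1 + \int[P]_x (expR (- lambda * dotf (sample_mean x)
  (sample_mean x)))%:E)%E); last first.
  transitivity (\int[P]_x (1 + (expR (- lambda * dotf (sample_mean x) (sample_mean
    x)))%:E))%E.
    apply: eq_integral => x _; rewrite -dot_vv.
    have := gauss_vec_cos (v x) 0; rewrite cos0 mul1r EFinD => <-.
    by apply: eq_integral => t _; rewrite /F addr0.
  have eS0 x : [set: T] x -> (0 <= (expR (- lambda * dotf (sample_mean x)
    (sample_mean x)))%:E)%E.
    by rewrite lee_fin expR_ge0.
  have p1 : P [set: T] = 1%E by exact: probability_setT.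
  rewrite (@ge0_integralD _ _ _ _ _ measurableT (fun=> 1%E) _ _ _ eS0 mE)//.
  by rewrite integral_cst// [X in (_ * X)%E]p1 mule1.
move=> FE; rewrite -(@leeD2lE _ 1%E)// FE.
apply: (@le_trans _ _ (\int[gauss_vec m]_t (1 + (E1 * expR (- qf H1 (tnth t) / 2) +
  E2 * expR (- qf H2 (tnth t) / 2)))%:E)%E).
  apply: ge0_le_integral => //.
  - by move=> t _; apply: integral_ge0.
  - exact: measurable_fun_fubini_tonelli_G.
  - apply/measurable_EFinP; apply: measurable_funD => //; apply: measurable_funD.
      by apply: measurable_funM => //; exact: mexpq.
    by apply: measurable_funM => //; exact: mexpq.
  - move=> t _.
    have icos : intg (fun x => cos (dotf (v x) (tnth t))).
      apply: intg_cos; apply: measurable_sum => k; apply: measurable_funM => //.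
      by apply: measurable_funM => //; exact: msm.
    rewrite -EFin_Rintg; last by apply: intgD => //; exact: intg_cst.
    rewrite lee_fin RintgD; [|exact: intg_cst|].
      rewrite Rintg_cst lerD2l; apply: le_trans (cos_sum_le (tnth t)).
      by under [leRHS]eq_Rintegral do rewrite sum_phase.
    exact: icos.
apply: (le_trans integral_gauss_vec_le).
rewrite -EFinD lee_fin lerD2l mulrDr mulr1 lerD//.
- rewrite -!expRD ler_expR.
  have -> : \sum_k H1 k k = 2 * lambda / n%:R * trQ by rewrite mulr_sumr.
  have -> : \sum_k \sum_l H1 k l ^+ 2 = (2 * lambda / n%:R) ^+ 2 * frobQ.
    rewrite mulr_sumr; apply: eq_bigr => k _; rewrite mulr_sumr.
    by apply: eq_bigr => l _; rewrite exprMn.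
  by rewrite le_eqVlt; apply/orP; left; apply/eqP; field; rewrite gt_eqF.
- rewrite -expRD ler_expR.
  have -> : \sum_k H2 k k = - (2 * kappa)^-1 * tau by rewrite mulr_sumr.
  rewrite (_ : - (3 * tau) / (4 * kappa) - - (2 * kappa)^-1 * tau = - (tau / (4 *
    kappa))); last first.
    by field; rewrite gt_eqF.
  rewrite mulNr lerN2 mulrA ler_pdivrMr//.
  have h1 : lambda * trQ <= lambda * (alpha * tau) by rewrite ler_wpM2l// trQ_le.
  apply: (le_trans h1).
  have tau0 : 0 <= alpha * tau.
    by apply: mulr_ge0; [exact: ltW|apply: sumr_ge0 => k _; rewrite -qf_delta].
  have h2 := ler_wpM2r tau0 lambda_le; apply: (le_trans h2).
  rewrite le_eqVlt; apply/orP; left; apply/eqP; field.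
  by rewrite !gt_eqF.
Qed.

End moment_generating_function.

End SampleMeanLowerTail.

(** * Matrices *)

Section PsdSquareRoot.
Context {R : realType}.

Lemma interpolation (s : seq R) (f : R -> R) :
  exists p : {poly R}, {in s, forall x, p.[x] = f x}.
Proof.
elim: s => [|x s [p ps]]; first by exists 0.
have [xs|xs] := boolP (x \in s).
  by exists p => y; rewrite inE => /predU1P[->|]; exact: ps.
pose w := \prod_(y <- s) ('X - y%:P).
have wx : w.[x] != 0.
  by rewrite -rootE root_prod_XsubC.
exists (p + ((f x - p.[x]) / w.[x]) *: w) => y; rewrite inE => /predU1P[->|ys].
  by rewrite hornerD hornerZ divfK// subrKC.
rewrite hornerD hornerZ ps//.
have /rootP -> : root w y by rewrite root_prod_XsubC.
by rewrite mulr0 addr0.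
Qed.

Section spectrum.
Import complex.

(** The spectral theorem is applied over the complex numbers, and only a real consequence is kept:
    polynomials vanishing at suitable real eigenvalues annihilate A. This is enough for a functional
    calculus without eigenvectors. *)
Lemma symmetric_annihilating (d : nat) (A : 'M[R]_d.+1) : A^T = A ->
  exists s : seq R, all (eigenvalue A) s /\
    forall r : {poly R}, {in s, forall x, r.[x] = 0} -> horner_mx A r = 0.
Proof.
move=> symA.
pose f := real_complex R.
pose Ac := map_mx f A.
have Asym : Ac \is symmetricmx.
  apply/is_hermitianmxP; rewrite expr0 scale1r.
  by apply/matrixP => i j; rewrite !mxE -[in RHS]symA mxE.
have Areal : Ac \is a mxOver Num.real.
  by apply/mxOverP => i j; rewrite mxE; apply/complex_realP; exists (A i j).
have Aherm := realsym_hermsym Asym Areal.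
have Dreal := hermitian_spectral_diag_real Aherm.
have /hermitian_normalmx/orthomx_spectralP AE := Aherm.
set V := spectralmx Ac in AE; set D := spectral_diag Ac in AE Dreal.
have Vunit : V \in unitmx by exact: spectral_unit.
pose e (i : 'I_d.+1) : R := complex.Re (D 0 i).
have De i : D 0 i = f (e i).
  by rewrite /e /f RRe_real//; exact: (mxOverP Dreal).
exists [seq e i | i <- enum 'I_d.+1]; split.
  apply/allP => _ /mapP[i _ ->].
  suff : eigenvalue Ac (D 0 i) by rewrite De eigenvalue_map.
  apply/eigenvalueP; exists (row i V); last first.
    apply/eqP => /(congr1 (mulmx^~ (invmx V))).
    rewrite -row_mul mulmxV// mul0mx => /rowP/(_ i).
    by rewrite !mxE eqxx => /eqP; rewrite oner_eq0.
  rewrite -/Ac AE -row_mul mulmxA mulmxA mulmxV// mul1mx.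
  by rewrite row_mul row_diag_mx -scalemxAl -rowE.
move=> r r0; apply: (@map_mx_inj _ _ f); rewrite map_mx0 map_horner_mx -/Ac.
have rD : map_mx (horner (map_poly f r)) D = 0.
  apply/rowP => i; rewrite !mxE De horner_map r0 ?rmorph0//.
  by apply/mapP; exists i => //; rewrite mem_enum.
have d0 : diag_mx (0 : 'rV[complex R]_d.+1) = 0 by exact: linear0.
by rewrite AE (horner_mx_uconjC _ _ Vunit) horner_mx_diag rD d0 mulmx0 mul0mx.
Qed.

End spectrum.

Lemma horner_mx_sym (d : nat) (A : 'M[R]_d.+1) (p : {poly R}) :
  A^T = A -> (horner_mx A p)^T = horner_mx A p.
Proof.
move=> symA; elim/poly_ind: p => [|p c IH]; first by rewrite rmorph0 trmx0.
rewrite rmorphD rmorphM/= horner_mx_X horner_mx_C linearD/= tr_scalar_mx.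
rewrite -[in LHS]mulmxE trmx_mul symA IH; congr (_ + _).
exact: (comm_mx_horner _ (comm_mx_refl A)).
Qed.

Lemma quadform_mulmx_tr (d : nat) (A : 'M[R]_d) (x : 'cV[R]_d) :
  quadform (A^T *m A) x = \sum_i (A *m x) i 0 ^+ 2.
Proof.
rewrite /quadform !mulmxA -trmx_mul -mulmxA mxE.
by apply: eq_bigr => i _; rewrite mxE expr2.
Qed.

(** The root is sought as a polynomial in A, which makes it symmetric. Polynomials are evaluated at
    matrices of size [d.+1], hence 0 < d. *)
Lemma sqrtmxP (d : nat) (A : 'M[R]_d) : (0 < d)%N -> psdmx A ->
  psdmx (sqrtmx A) /\ sqrtmx A *m sqrtmx A = A.
Proof.
case: d A => // d A _ [symA A0].
suff [S HS] : exists S : 'M[R]_d.+1, psdmx S /\ S *m S = A.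
  by rewrite /sqrtmx; have := @xgetPex _ 0 [set S | psdmx S /\ S *m S = A]
    (ex_intro _ S HS).
have [s [/allP eig ann]] := symmetric_annihilating symA.
have s0 x : x \in s -> 0 <= x.
  move=> /eig /eigenvalueP[v vA v0].
  have := A0 v^T; rewrite /quadform trmxK vA -scalemxAl mxE mxE pmulr_lge0//.
  rewrite lt_neqAle; apply/andP; split; last first.
    by apply: sumr_ge0 => i _; rewrite mxE -expr2 sqr_ge0.
  apply: contra v0 => /eqP/esym v20.
  apply/eqP/rowP => i; rewrite mxE.
  have /psumr_eq0P := v20 => /(_ _ i isT).
  rewrite mxE -expr2 => H; apply/eqP; rewrite -sqrf_eq0; apply/eqP/H => j _.
  by rewrite mxE -expr2 sqr_ge0.
(* [q] interpolates the fourth root, so that the square root is itself a square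
   and hence positive semidefinite. *)
have [q qs] := interpolation s (fun x => Num.sqrt (Num.sqrt x)).
pose B := horner_mx A q.
have symB : B^T = B by exact: horner_mx_sym.
exists (B *m B); split; first split.
- by rewrite trmx_mul symB.
- by move=> x; rewrite -{1}symB quadform_mulmx_tr sumr_ge0// => i _;
    rewrite sqr_ge0.
apply/eqP; rewrite -subr_eq0 !mulmxE -!rmorphM -[X in _ - X]horner_mx_X -rmorphB;
  apply/eqP.
apply: ann => x xs.
rewrite hornerD hornerN hornerX !hornerM qs//.
by rewrite -!expr2 !sqr_sqrtr ?sqrtr_ge0 ?s0// subrr.
Qed.

End PsdSquareRoot.

Section FrobeniusOperatorNorm.
Context {R : realType}.

Lemma cauchy_schwarz_sum (I : finType) (a b : I -> R) :
  (\sum_i a i * b i) ^+ 2 <= (\sum_i a i ^+ 2) * (\sum_i b i ^+ 2).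
Proof.
set C := \sum_i a i * b i; set A := \sum_i _; set B := \sum_i _ ^+ 2.
have B0 : 0 <= B by apply: sumr_ge0 => i _; exact: sqr_ge0.
have H : 0 <= B * (B * A - C ^+ 2).
  rewrite (_ : _ * _ = \sum_i (B * a i - C * b i) ^+ 2).
    by apply: sumr_ge0 => i _; exact: sqr_ge0.
  transitivity (B ^+ 2 * A - 2 * B * C * C + C ^+ 2 * B); first by ring.
  rewrite [B ^+ 2 * A]mulr_sumr [2 * B * C * C]mulr_sumr [C ^+ 2 * B]mulr_sumr.
  by rewrite -sumrB -big_split/=; apply: eq_bigr => i _; ring.
move: B0; rewrite le_eqVlt => /predU1P[B0|B0]; last first.
  by rewrite mulrC -subr_ge0 -(pmulr_rge0 _ B0).
have b0 i : b i = 0.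
  apply/eqP; rewrite -sqrf_eq0; apply/eqP.
  by have /esym/psumr_eq0P := B0; apply => // j _; exact: sqr_ge0.
rewrite /C big1 => [|i _]; last by rewrite b0 mulr0.
by rewrite expr0n/= -B0 mulr0.
Qed.

Lemma frob_ge0 (m n : nat) (A : 'M[R]_(m, n)) : 0 <= frob A.
Proof. exact: sqrtr_ge0. Qed.

Lemma sqr_frob (m n : nat) (A : 'M[R]_(m, n)) :
  frob A ^+ 2 = \sum_i \sum_j A i j ^+ 2.
Proof.
by rewrite sqr_sqrtr// sumr_ge0// => i _; rewrite sumr_ge0// => j _; exact: sqr_ge0.
Qed.

Lemma sqr_frob_col (m : nat) (x : 'cV[R]_m) : frob x ^+ 2 = \sum_i x i 0 ^+ 2.
Proof. by rewrite sqr_frob; apply: eq_bigr => i _; rewrite big_ord1. Qed.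

Lemma frob_tr (m n : nat) (A : 'M[R]_(m, n)) : frob A^T = frob A.
Proof.
congr Num.sqrt; rewrite exchange_big/=; apply: eq_bigr => i _.
by apply: eq_bigr => j _; rewrite mxE.
Qed.

Lemma frobZ (m n : nat) (c : R) (A : 'M[R]_(m, n)) : frob (c *: A) = `|c| * frob A.
Proof.
apply/eqP; rewrite -(eqrXn2 (isT : (0 < 2)%N)) ?frob_ge0 ?mulr_ge0 ?frob_ge0//.
rewrite exprMn real_normK ?num_real// !sqr_frob mulr_sumr; apply/eqP.
apply: eq_bigr => i _; rewrite mulr_sumr; apply: eq_bigr => j _.
by rewrite mxE exprMn.
Qed.

Lemma frob0 (m n : nat) : frob (0 : 'M[R]_(m, n)) = 0.
Proof. by rewrite -(scale0r 0) frobZ normr0 mul0r. Qed.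

Lemma frob_eq0 (m : nat) (x : 'cV[R]_m) : frob x = 0 -> x = 0.
Proof.
move=> x0; have := sqr_frob_col x; rewrite x0 expr0n/= => /esym/psumr_eq0P H.
apply/colP => i; rewrite mxE; apply/eqP; rewrite -sqrf_eq0; apply/eqP.
by apply: H => // j _; exact: sqr_ge0.
Qed.

Lemma frob_mulmx_col_le (m n : nat) (A : 'M[R]_(m, n)) (x : 'cV[R]_n) :
  frob (A *m x) <= frob A * frob x.
Proof.
rewrite -ler_sqr ?nnegrE ?mulr_ge0 ?frob_ge0//
  exprMn !sqr_frob_col sqr_frob mulr_suml.
by apply: ler_sum => i _; rewrite mxE; exact: cauchy_schwarz_sum.
Qed.

Lemma opnorm_ub (m n : nat) (A : 'M[R]_(m, n)) (x : 'cV[R]_n) :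
  frob (A *m x) <= opnorm A * frob x.
Proof.
have [/eqP/frob_eq0 ->|x0] := boolP (frob x == 0).
  by rewrite mulmx0 !frob0 mulr0.
have fx : 0 < frob x by rewrite lt_neqAle eq_sym x0 frob_ge0.
rewrite -ler_pdivrMr// mulrC.
have -> : (frob x)^-1 * frob (A *m x) = frob (A *m ((frob x)^-1 *: x)).
  by rewrite -scalemxAr frobZ ger0_norm// invr_ge0 ltW.
apply: ub_le_sup.
  exists (frob A) => _ [y /= y1 <-]; rewrite (le_trans (frob_mulmx_col_le _ _))//.
  by rewrite ler_piMr// frob_ge0.
have n1 : frob ((frob x)^-1 *: x) = 1.
  have ifx : 0 < (frob x)^-1 by rewrite invr_gt0.
  by rewrite frobZ (gtr0_norm ifx) mulVf// gt_eqF.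
by exists ((frob x)^-1 *: x) => //=; rewrite n1.
Qed.

Lemma opnorm_ge0 (m n : nat) (A : 'M[R]_(m, n)) : 0 <= opnorm A.
Proof.
apply: ub_le_sup; last by exists 0; rewrite /= ?mulmx0 frob0.
exists (frob A) => _ [y /= y1 <-]; rewrite (le_trans (frob_mulmx_col_le _ _))//.
by rewrite ler_piMr// frob_ge0.
Qed.

Lemma opnorm_le (m n : nat) (A : 'M[R]_(m, n)) (c : R) : 0 <= c ->
  (forall x : 'cV[R]_n, frob (A *m x) <= c * frob x) -> opnorm A <= c.
Proof.
move=> c0 H; apply: ge_sup.
  by exists (frob (A *m (0 : 'cV[R]_n))); exists 0 => //=; rewrite frob0.
by move=> _ [y /= y1 <-]; rewrite (le_trans (H y))// ler_piMr.
Qed.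

Lemma opnormM (m n p : nat) (A : 'M[R]_(m, n)) (B : 'M[R]_(n, p)) :
  opnorm (A *m B) <= opnorm A * opnorm B.
Proof.
apply: opnorm_le => [|x]; first by rewrite mulr_ge0 ?opnorm_ge0.
rewrite -mulmxA (le_trans (opnorm_ub _ _))// -mulrA ler_wpM2l ?opnorm_ge0//.
exact: opnorm_ub.
Qed.

Lemma opnorm_gt0 (n : nat) (A : 'M[R]_n) : (0 < n)%N -> A \in unitmx -> 0 < opnorm
  A.
Proof.
case: n A => // n A _ Au.
rewrite lt_neqAle opnorm_ge0 andbT; apply/eqP => /esym A0.
pose x : 'cV[R]_n.+1 := const_mx 1.
have : A *m x = 0.
  apply: frob_eq0; apply/eqP; rewrite eq_le frob_ge0 andbT.
  by rewrite (le_trans (opnorm_ub A x))// A0 mul0r.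
move=> /(congr1 (mulmx (invmx A))); rewrite mulKmx// mulmx0 => /colP/(_ 0).
by rewrite !mxE => /eqP; rewrite oner_eq0.
Qed.

Lemma sqr_frob_cols (m n : nat) (A : 'M[R]_(m, n)) :
  frob A ^+ 2 = \sum_j frob (col j A) ^+ 2.
Proof.
rewrite sqr_frob exchange_big; apply: eq_bigr => j _.
by rewrite sqr_frob_col; apply: eq_bigr => i _; rewrite mxE.
Qed.

(** Column by column, |S x|^2 = <x, Sigma x> <= |x| |Sigma x|. The operator norm of Sigma enters
    directly, without that of its square root. *)
Lemma sqr_frob_sqrt_le (d p : nat) (S Sigma : 'M[R]_d) (V : 'M[R]_(d, p)) :
  S^T = S -> S *m S = Sigma -> frob (S *m V) ^+ 2 <= opnorm Sigma * frob V ^+ 2.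
Proof.
move=> symS SS; rewrite !sqr_frob_cols mulr_sumr; apply: ler_sum => j _.
rewrite (_ : col j (S *m V) = S *m col j V); last by rewrite !colE mulmxA.
set x := col j V.
have -> : frob (S *m x) ^+ 2 = \sum_i x i 0 * (Sigma *m x) i 0.
  rewrite sqr_frob_col -quadform_mulmx_tr symS SS /quadform -mulmxA mxE.
  by apply: eq_bigr => i _; rewrite mxE.
have CS : \sum_i x i 0 * (Sigma *m x) i 0 <= frob x * frob (Sigma *m x).
  rewrite (le_trans (ler_norm _))// -ler_sqr ?nnegrE ?mulr_ge0 ?frob_ge0//.
  by rewrite real_normK ?num_real// exprMn !sqr_frob_col cauchy_schwarz_sum.
rewrite (le_trans CS)// expr2 mulrCA ler_wpM2l ?frob_ge0//; exact: opnorm_ub.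
Qed.

Lemma sqr_frob_conj_sqrt_le (d : nat) (S Sigma V : 'M[R]_d) :
  S^T = S -> S *m S = Sigma ->
  frob (S *m V *m S) ^+ 2 <= opnorm Sigma ^+ 2 * frob V ^+ 2.
Proof.
move=> symS SS; rewrite -mulmxA (le_trans (sqr_frob_sqrt_le _ symS SS))//.
rewrite [opnorm Sigma ^+ 2]expr2 -mulrA ler_wpM2l ?opnorm_ge0//.
by rewrite -frob_tr trmx_mul symS (le_trans (sqr_frob_sqrt_le _ symS SS))// frob_tr.
Qed.

End FrobeniusOperatorNorm.

Section VectorizedMatrices.
Context {R : realType} {d : nat}.
Local Notation idx := (enum_val : 'I_#|{: 'I_d * 'I_d}| -> 'I_d * 'I_d).

(** Matrices are flattened to coordinates indexed by an ordinal, the format of the Gaussian vectors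
    and quadratic forms above; [dotf] becomes the Frobenius inner product. *)
Definition vecf (V : 'M[R]_d) (k : 'I_#|{: 'I_d * 'I_d}|) : R :=
  V (idx k).1 (idx k).2.

Definition unvecf (v : 'I_#|{: 'I_d * 'I_d}| -> R) : 'M[R]_d :=
  \matrix_(i, j) v (enum_rank (i, j)).

Lemma unvecfK v : vecf (unvecf v) = v.
Proof. by apply/funext => k; rewrite /vecf mxE -surjective_pairing enum_valK. Qed.

Lemma sum_idx (F : 'I_d -> 'I_d -> R) : \sum_k F (idx k).1 (idx k).2 = \sum_i \sum_j
  F i j.
Proof.
rewrite pair_bigA/= (reindex idx)/=; first exact: eq_bigl.
exact: onW_bij (enum_val_bij _).
Qed.

Lemma mxtrace_trmulmx (V W : 'M[R]_d) : \tr (V^T *m W) = \sum_i \sum_j V i j * W i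
  j.
Proof.
rewrite exchange_big; apply: eq_bigr => j _; rewrite mxE.
by apply: eq_bigr => i _; rewrite mxE.
Qed.

Lemma dotf_vecf (V W : 'M[R]_d) : dotf (vecf V) (vecf W) = \tr (V^T *m W).
Proof. by rewrite mxtrace_trmulmx -(sum_idx (fun i j => V i j * W i j)). Qed.

Lemma sqr_frob_tr (V : 'M[R]_d) : frob V ^+ 2 = \tr (V^T *m V).
Proof.
rewrite sqr_frob mxtrace_trmulmx; apply: eq_bigr => i _; apply: eq_bigr => j _.
by rewrite expr2.
Qed.

(** The Kronecker square of S; for symmetric S, the matrix of the map V -> S V S. *)
Definition kronf (S : 'M[R]_d) (k l : 'I_#|{: 'I_d * 'I_d}|) : R :=
  S (idx k).1 (idx l).1 * S (idx k).2 (idx l).2.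

Lemma qf_kronf (S V : 'M[R]_d) : S^T = S ->
  qf (kronf S) (vecf V) = \tr (V^T *m (S *m V *m S)).
Proof.
move=> symS; rewrite mxtrace_trmulmx -(sum_idx (fun i j => V i j * (S *m V *m S) i
  j)).
apply: eq_bigr => k _; rewrite /kronf /vecf.
rewrite (sum_idx (fun p q => S (idx k).1 p * S (idx k).2 q * V (idx k).1 (idx k).2 *
  V p q)).
rewrite mxE mulr_sumr exchange_big; apply: eq_bigr => q _.
rewrite mxE mulr_suml mulr_sumr; apply: eq_bigr => p _.
by rewrite -{2}symS mxE; ring.
Qed.

Lemma sum_kronf_diag (S : 'M[R]_d) : \sum_k kronf S k k = (\tr S) ^+ 2.
Proof.
rewrite /kronf (sum_idx (fun i j => S i i * S j j)) expr2 /mxtrace mulr_suml.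
by apply: eq_bigr => i _; rewrite mulr_sumr.
Qed.

Lemma qf_kronf_sqrt (S Q V : 'M[R]_d) : Q^T = Q -> Q *m Q = S ->
  qf (kronf S) (vecf V) = frob (Q *m V *m Q) ^+ 2.
Proof.
move=> symQ QQ; rewrite qf_kronf; last by rewrite -QQ trmx_mul symQ.
rewrite sqr_frob_tr !trmx_mul !symQ -QQ.
have -> : Q *m (V^T *m Q) *m (Q *m V *m Q) = Q *m (V^T *m (Q *m Q *m V *m Q)).
  by rewrite !mulmxA.
by rewrite [RHS]mxtrace_mulC !mulmxA.
Qed.

Lemma kronf_sym (S : 'M[R]_d) k l : S^T = S -> kronf S k l = kronf S l k.
Proof. by move=> symS; rewrite /kronf -{1 2}symS !mxE. Qed.

Definition cov_dev (S : 'M[R]_d) (u : d.-tuple R) : 'M[R]_d :=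
  colv u *m (colv u)^T - S.

Lemma quadformE (V : 'M[R]_d) (x : 'cV[R]_d) : quadform V x = \tr (V *m (x *m x^T)).
Proof.
by rewrite mulmxA mxtrace_mulC mulmxA /mxtrace big_ord1.
Qed.

Lemma quadform_sum (V : 'M[R]_d) (x : 'cV[R]_d) :
  quadform V x = \sum_i \sum_j V i j * (x i 0 * x j 0).
Proof.
rewrite quadformE -[V]trmxK mxtrace_trmulmx exchange_big.
apply: eq_bigr => i _; apply: eq_bigr => j _.
by rewrite !mxE big_ord1 !mxE; ring.
Qed.

(** With x = [colv u], the form is (x^T S x)^2 - 2 x^T S^3 x + tr S^4. It is written through <S, A>
    and <S^3, A>, where A = x x^T - S, because these have zero expectation when S = Sigma. *)
Lemma qf_kronf_dev (S : 'M[R]_d) (u : d.-tuple R) : S^T = S ->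
  qf (kronf S) (vecf (cov_dev S u)) =
  (dotf (vecf S) (vecf (cov_dev S u)) + \tr (S *m S)) ^+ 2
  - 2 * (dotf (vecf (S *m S *m S)) (vecf (cov_dev S u)) + \tr (S *m S *m (S *m S)))
  + \tr (S *m S *m (S *m S)).
Proof.
move=> symS; rewrite qf_kronf// !dotf_vecf !trmx_mul symS.
set x := colv u.
have symD : (cov_dev S u)^T = cov_dev S u.
  by rewrite /cov_dev linearB/= trmx_mul trmxK symS.
rewrite symD /cov_dev -/x.
pose s : R := \tr (S *m (x *m x^T)).
pose t : R := \tr (S *m (S *m S) *m (x *m x^T)).
have xSx : x^T *m S *m x = s%:M.
  by rewrite [LHS]mx11_scalar; congr (_%:M);
    rewrite -[LHS]/(quadform S x) quadformE.
have E1 : \tr (x *m x^T *m (S *m (x *m x^T) *m S)) = s ^+ 2.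
  have -> : x *m x^T *m (S *m (x *m x^T) *m S) = x *m (x^T *m S *m x) *m (x^T *m S).
    by rewrite !mulmxA.
  rewrite xSx mul_mx_scalar -scalemxAl linearZ/= expr2; congr (_ * _).
  by rewrite mulmxA mxtrace_mulC.
have E2 : \tr (x *m x^T *m (S *m S *m S)) = t by rewrite mxtrace_mulC -mulmxA.
have E3 : \tr (S *m (S *m (x *m x^T) *m S)) = t.
  by rewrite /t !mulmxA mxtrace_mulC !mulmxA.
have trB (A B : 'M[R]_d) : \tr (A - B) = \tr A - \tr B by exact: linearB.
have D1 : \tr (S *m (x *m x^T - S)) = s - \tr (S *m S) by rewrite mulmxBr trB.
have D2 : \tr (S *m (S *m S) *m (x *m x^T - S)) = t - \tr (S *m S *m (S *m S)).
  by rewrite mulmxBr trB /t !mulmxA.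
have D3 : \tr ((x *m x^T - S) *m (S *m (x *m x^T - S) *m S)) =
    s ^+ 2 - t - (t - \tr (S *m S *m (S *m S))).
  rewrite [S *m (_ - _)]mulmxBr [(_ - _) *m S]mulmxBl mulmxBl.
  rewrite [x *m x^T *m (_ - _)]mulmxBr [S *m (_ - _)]mulmxBr !trB E1 E2 E3.
  by rewrite !mulmxA.
by rewrite D1 D2 D3; ring.
Qed.

End VectorizedMatrices.

(** * Lower tail of the Frobenius error *)

(** [l1] is the cap and [l2] balances the two summands on the left. The linear branch of the maximum
    at [l1], or the square-root branch at [l2], makes the right side at least 2 L. At the smaller of
    [l1] and [l2] the quadratic summand is at most L. *)
Lemma chernoff_choice (R : realType) (N al kap F L : R) :
  0 < N -> 0 < al -> 0 < kap -> 0 < F -> 0 < L ->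
  exists lam, [/\ 0 <= lam, lam <= N / (4 * al * kap) &
    L + 8 * F * kap ^+ 2 * lam ^+ 2 / N ^+ 2 <=
    lam * (4 * kap / N * Num.max (2 * al * L) (Num.sqrt (2 * F * L)))].
Proof.
move=> N0 al0 kap0 F0 L0.
pose l1 := N / (4 * al * kap); pose l2 := N / kap * Num.sqrt (L / (8 * F)).
have c0 : 0 <= 4 * kap / N by rewrite divr_ge0 ?mulr_ge0 ?ltW.
have l10 : 0 <= l1 by rewrite divr_ge0 ?mulr_ge0 ?ltW.
have l20 : 0 <= l2 by rewrite mulr_ge0 ?sqrtr_ge0// divr_ge0 ?ltW.
have LF0 : 0 <= L / (8 * F) by rewrite divr_ge0 ?mulr_ge0 ?ltW.
have E2 : 8 * F * kap ^+ 2 * l2 ^+ 2 / N ^+ 2 = L.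
  by rewrite /l2 exprMn sqr_sqrtr//; field; rewrite !gt_eqF.
have [l12|l21] := leP l1 l2.
  exists l1; split => //.
  apply: (@le_trans _ _ (l1 * (4 * kap / N * (2 * al * L)))); last first.
    by rewrite ler_wpM2l// ler_wpM2l// le_max lexx.
  rewrite (_ : l1 * _ = L + L); last by rewrite /l1; field; rewrite !gt_eqF.
  rewrite lerD2l -[leRHS]E2 ler_wpM2r ?invr_ge0 ?sqr_ge0//.
  by rewrite ler_wpM2l ?lerXn2r// !mulr_ge0 ?sqr_ge0// ltW.
exists l2; split => //; first exact: ltW.
rewrite E2; apply: (@le_trans _ _ (l2 * (4 * kap / N * Num.sqrt (2 * F * L))));
  last first.
  by rewrite ler_wpM2l// ler_wpM2l// le_max lexx orbT.
rewrite (_ : l2 * _ = 4 * (Num.sqrt (L / (8 * F)) * Num.sqrt (2 * F * L)));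
  last first.
  by rewrite /l2; field; rewrite !gt_eqF.
rewrite -sqrtrM// (_ : L / (8 * F) * (2 * F * L) = (L / 2) ^+ 2); last by field;
  rewrite gt_eqF.
rewrite sqrtr_sqr ger0_norm; last by rewrite divr_ge0 ?ltW.
lra.
Qed.

Section CovarianceMatrix.
Context {dT : measure_display} {T : measurableType dT} {R : realType}
  (P : probability T R) {d : nat} (X : {RV P >-> d.-tuple R}).
Local Notation intg f := (P.-integrable [set: T] (EFin \o f)).
Hypothesis hX2 : square_integrable X.

Lemma expectE (Y : T -> R) : expect P Y = \int[P]_w Y w.
Proof. by rewrite /expect unlock. Qed.

Lemma intg_mul_coord i j : intg (fun w => tnth (X w) i * tnth (X w) j).
Proof.
have := Lfun2_mul_Lfun1 (hX2 i) (hX2 j).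
by move=> /Lfun1_integrable.
Qed.

Lemma covmxE i j : covmx X i j = \int[P]_w (tnth (X w) i * tnth (X w) j).
Proof.
rewrite mxE expectE; apply: eq_Rintegral => w _.
by rewrite mxE big_ord1 !mxE.
Qed.

Lemma covmx_sym : (covmx X)^T = covmx X.
Proof.
apply/matrixP => i j; rewrite mxE !covmxE; apply: eq_Rintegral => w _.
by rewrite mulrC.
Qed.

Lemma Rintg_quadform (V : 'M[R]_d) :
  \int[P]_w quadform V (colv (X w)) = \sum_i \sum_j V i j * covmx X i j.
Proof.
transitivity (\int[P]_w \sum_i \sum_j V i j * (tnth (X w) i * tnth (X w) j)).
  apply: eq_Rintegral => w _; rewrite quadform_sum.
  by apply: eq_bigr => i _; apply: eq_bigr => j _; rewrite !mxE.
have iX := intg_mul_coord.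
rewrite Rintg_sum => [|i]; last by apply: intg_sum => j; exact: intgZ.
apply: eq_bigr => i _; rewrite Rintg_sum => [|j]; last exact: intgZ.
by apply: eq_bigr => j _; rewrite RintgZ// covmxE.
Qed.

Lemma covmx_psd : psdmx (covmx X).
Proof.
split=> [|x]; first exact: covmx_sym.
rewrite quadform_sum.
have -> : \sum_i \sum_j covmx X i j * (x i 0 * x j 0) =
    \int[P]_w quadform (x *m x^T) (colv (X w)).
  rewrite Rintg_quadform; apply: eq_bigr => i _; apply: eq_bigr => j _.
  by rewrite !mxE big_ord1 !mxE mulrC.
apply: Rintegral_ge0 => w _.
rewrite /quadform !mulmxA -mulmxA -[(colv (X w))^T *m x]trmxK trmx_mul trmxK.
by rewrite mxE big_ord1 mxE -expr2 sqr_ge0.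
Qed.

(** Inserting S V S, with S the square root of the covariance, turns the moment assumption on the
    standardized vector into one on X, with |S V S|_F on the right. *)
Lemma quadform_standardized (V : 'M[R]_d) (w : T) : (0 < d)%N -> covmx X \in unitmx
  ->
  quadform (sqrtmx (covmx X) *m V *m sqrtmx (covmx X)) (standardized X w) =
  quadform V (colv (X w)).
Proof.
move=> d0 Su; have [[symS _] SS] := sqrtmxP d0 covmx_psd.
set S := sqrtmx _ in symS SS *.
have uS : S \in unitmx by move: Su; rewrite -SS unitmx_mul => /andP[].
rewrite /quadform /standardized -/S trmx_mul trmx_inv symS.
by rewrite !mulmxA mulmxKV// -[_ *m invmx S]mulmxA mulmxV// mulmx1.
Qed.

End CovarianceMatrix.

Section DeviationMoments.
Context {dT : measure_display} {T : measurableType dT} {R : realType}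
  (P : probability T R) {d : nat} (X : {RV P >-> d.-tuple R}).
Local Notation intg f := (P.-integrable [set: T] (EFin \o f)).
Local Notation Sigma := (covmx X).
Hypotheses (d0 : (0 < d)%N) (hX2 : square_integrable X) (Su : Sigma \in unitmx).
Variable alpha : R.
Hypothesis hmoment : forall V : 'M[R]_d,
  let q := fun w => quadform V (standardized X w) in
  ('E_P[fun w => ((q w - expect P q) ^+ 4)%R] <= (alpha ^+ 2 * frob V ^+ 4)%:E)%E.

Definition cov_coord (S : 'M[R]_d) k (u : d.-tuple R) : R := vecf (cov_dev S u) k.
Local Notation a := (cov_coord Sigma).

Lemma measurable_cov_coord S k : measurable_fun [set: d.-tuple R] (cov_coord S k).
Proof.
rewrite (_ : cov_coord S k = fun u =>
  tnth u (enum_val k).1 * tnth u (enum_val k).2 - S (enum_val k).1 (enum_val k).2).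
  by apply: measurable_funB => //; apply: measurable_funM; exact: measurable_tnth.
by apply/funext => u; rewrite /cov_coord /vecf !mxE big_ord1 !mxE.
Qed.

Lemma Rintg_cov_coord k : \int[P]_w a k (X w) = 0.
Proof.
transitivity (\int[P]_w (tnth (X w) (enum_val k).1 * tnth (X w) (enum_val k).2
   - Sigma (enum_val k).1 (enum_val k).2)).
  by apply: eq_Rintegral => w _; rewrite /cov_coord /vecf !mxE big_ord1 !mxE.
rewrite RintgB; [|exact: intg_mul_coord|exact: intg_cst].
by rewrite Rintg_cst covmxE subrr.
Qed.

Lemma dotf_cov_coord (V : 'M[R]_d) w : dotf (vecf V) (a^~ (X w)) =
  quadform V (colv (X w)) - \int[P]_w quadform V (colv (X w)).
Proof.
rewrite dotf_vecf /cov_dev mulmxBr linearB/= !mxtrace_trmulmx Rintg_quadform//.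
congr (_ - _); rewrite quadform_sum; apply: eq_bigr => i _; apply: eq_bigr => j _.
by rewrite !mxE big_ord1 !mxE.
Qed.

Let integral_dot4 (V : 'M[R]_d) :
  (\int[P]_w (dotf (vecf V) (a^~ (X w)) ^+ 4)%:E <=
   (alpha ^+ 2 * qf (kronf Sigma) (vecf V) ^+ 2)%:E)%E.
Proof.
have [[symS _] SS] := sqrtmxP d0 (covmx_psd hX2).
rewrite (qf_kronf_sqrt _ symS SS) -exprM.
have := hmoment (sqrtmx Sigma *m V *m sqrtmx Sigma).
rewrite /= expectE unlock; apply: le_trans.
rewrite le_eqVlt; apply/orP; left; apply/eqP; apply: eq_integral => w _.
congr (_ ^+ 4)%:E; rewrite dotf_cov_coord; congr (_ - _).
  by rewrite quadform_standardized.
by apply: eq_Rintegral => v _; rewrite quadform_standardized.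
Qed.

(** Integrability comes from the moment assumption itself, which bounds an extended real integral by
    a finite number. *)
Lemma intg_dot4_cov (v : 'I_#|{: 'I_d * 'I_d}| -> R) :
  intg (fun w => dotf v (a^~ (X w)) ^+ 4).
Proof.
apply/integrableP; split.
  apply/measurable_EFinP; apply: measurable_funX; apply: measurable_sum => k.
  apply: measurable_funM => //; exact: (measurableT_comp (measurable_cov_coord _
    k)).
rewrite -(unvecfK v); apply: le_lt_trans (ltry _);
  apply: le_trans (integral_dot4 _).
rewrite le_eqVlt; apply/orP; left; apply/eqP; apply: eq_integral => w _ /=.
by rewrite ger0_norm// (exprM _ 2 2) sqr_ge0.
Qed.

Lemma Rintg_dot4_cov (v : 'I_#|{: 'I_d * 'I_d}| -> R) :
  \int[P]_w (dotf v (a^~ (X w)) ^+ 4) <= alpha ^+ 2 * qf (kronf Sigma) v ^+ 2.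
Proof.
by rewrite -lee_fin EFin_Rintg; [rewrite -(unvecfK v)|exact: intg_dot4_cov].
Qed.

Lemma intg_cov_coord4 k : intg (fun w => a k (X w) ^+ 4).
Proof.
have := intg_dot4_cov (fun l => (l == k)%:R).
congr (integrable _ _ _); apply/funext => w /=; congr (_ ^+ 4)%:E.
rewrite /dotf (bigD1 k)//= eqxx mul1r big1 ?addr0// => l lk.
by rewrite (negbTE lk) mul0r.
Qed.

Lemma qf_kronf_ge0 v : 0 <= qf (kronf Sigma) v.
Proof.
have [[symS _] SS] := sqrtmxP d0 (covmx_psd hX2).
by rewrite -(unvecfK v) (qf_kronf_sqrt _ symS SS) sqr_ge0.
Qed.

Lemma qf_kronf_le v : qf (kronf Sigma) v <= opnorm Sigma ^+ 2 * dotf v v.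
Proof.
have [[symS _] SS] := sqrtmxP d0 (covmx_psd hX2).
rewrite -(unvecfK v) (qf_kronf_sqrt _ symS SS) dotf_vecf -sqr_frob_tr.
exact: sqr_frob_conj_sqrt_le.
Qed.

Hypothesis alpha0 : 0 < alpha.

(** In the expectation of [qf_kronf_dev] the linear deviations vanish, and E <Sigma, A>^2 <= alpha
    tr Sigma^4 because Q <= alpha K. What remains is at most (tr Sigma^2)^2 + alpha tr Sigma^4, and
    [frobQ_le] multiplies it by alpha. *)
Lemma frob_cov_second_moment_le :
  \sum_k \sum_l second_moment X a k l ^+ 2 <=
  alpha * \tr (Sigma *m Sigma) ^+ 2 + alpha ^+ 2 * \tr (Sigma *m Sigma *m (Sigma *m
    Sigma)).
Proof.
have mc := measurable_cov_coord Sigma.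
have := frobQ_le mc intg_cov_coord4 Rintg_cov_coord qf_kronf_ge0 alpha0
  Rintg_dot4_cov.
move=> /le_trans; apply.
rewrite (_ : _ + _ = alpha * (alpha * \tr (Sigma *m Sigma *m (Sigma *m Sigma)) + \tr
  (Sigma *m Sigma) ^+ 2)); last by ring.
rewrite ler_wpM2l ?(ltW alpha0)//.
have symS := covmx_sym X.
pose D1 w := dotf (vecf Sigma) (a^~ (X w)).
pose D3 w := dotf (vecf (Sigma *m Sigma *m Sigma)) (a^~ (X w)).
set s2 := \tr (Sigma *m Sigma); set s4 := \tr (Sigma *m Sigma *m (Sigma *m Sigma)).
have s40 : 0 <= s4.
  by rewrite /s4 -{1 2}symS -trmx_mul -sqr_frob_tr sqr_ge0.
have i1 : intg D1 by exact: (intg_dot mc intg_cov_coord4).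
have i3 : intg D3 by exact: (intg_dot mc intg_cov_coord4).
have i2 : intg (fun w => D1 w ^+ 2) by exact: (intg_dot2 mc intg_cov_coord4).
have E w : qf (kronf Sigma) (a^~ (X w)) = ((D1 w ^+ 2 + 2 * s2 * D1 w) + - 2 * D3 w)
  + (s2 ^+ 2 - s4).
  by rewrite qf_kronf_dev// -/(D1 w) -/(D3 w) -/s2 -/s4; ring.
under eq_Rintegral do rewrite E.
have j1 := intgZ (2 * s2) i1; have j3 := intgZ (- 2) i3.
rewrite (RintgD (intgD (intgD i2 j1) j3) (intg_cst P _)) (RintgD (intgD i2 j1) j3)
  (RintgD i2 j1).
rewrite (RintgZ _ i1) (RintgZ _ i3) Rintg_cst.
rewrite (Rintg_dot mc intg_cov_coord4 Rintg_cov_coord) (Rintg_dot mc intg_cov_coord4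
  Rintg_cov_coord).
rewrite (Rintg_dot_sqr mc intg_cov_coord4).
have := qf_second_moment_le mc intg_cov_coord4 Rintg_cov_coord qf_kronf_ge0 alpha0
  Rintg_dot4_cov (vecf Sigma).
rewrite qf_kronf// symS.
rewrite (_ : \tr (Sigma *m (Sigma *m Sigma *m Sigma)) = s4);
  last by rewrite /s4 !mulmxA.
lra.
Qed.

End DeviationMoments.

Section EffectiveRank.
Context {R : realType} {d : nat}.

Lemma expmx2 (S : 'M[R]_d) : S ^+ 2 = S *m S.
Proof. by []. Qed.

Lemma expmx4 (S : 'M[R]_d) : S ^+ 4 = S *m S *m (S *m S).
Proof. by rewrite -mulmxA. Qed.

Lemma opnorm_le_frob (S : 'M[R]_d) : opnorm S <= frob S.
Proof. by apply: opnorm_le; [exact: frob_ge0|exact: frob_mulmx_col_le]. Qed.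

(** Submultiplicativity of the operator norm suffices: the effective rank only has to dominate the
    trace divided by |S|^2. *)
Lemma effrank_expmx2_ge (S : 'M[R]_d) : (0 < d)%N -> S \in unitmx -> S^T = S ->
  \tr (S *m S) / opnorm S ^+ 2 <= effrank (S ^+ 2).
Proof.
move=> d0 uS symS; rewrite /effrank expmx2 ler_wpM2l//.
  by rewrite -{1}symS -sqr_frob_tr sqr_ge0.
rewrite lef_pV2 ?posrE ?exprn_gt0 ?opnorm_gt0 ?unitmx_mul ?uS//.
by rewrite expr2 opnormM.
Qed.

Lemma effrank_expmx4_ge (S : 'M[R]_d) : (0 < d)%N -> S \in unitmx -> S^T = S ->
  \tr (S *m S *m (S *m S)) / opnorm S ^+ 4 <= effrank (S ^+ 4).
Proof.
move=> d0 uS symS; rewrite /effrank expmx4 ler_wpM2l//.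
  by rewrite -{1 2}symS -trmx_mul -sqr_frob_tr sqr_ge0.
rewrite lef_pV2 ?posrE ?exprn_gt0 ?opnorm_gt0 ?unitmx_mul ?uS//.
rewrite (exprM _ 2 2) expr2 (le_trans (opnormM _ _))//.
by rewrite ler_pM ?opnorm_ge0// expr2 opnormM.
Qed.

End EffectiveRank.

Lemma mutually_independent_some (dT dU : measure_display) (T : measurableType dT)
    (U : measurableType dU) (R : realType) (P : probability T R) (n : nat)
    (X : {RV P >-> U}) (Xs : 'I_n -> {RV P >-> U}) :
  mutually_independent (fun o : option 'I_n => if o is Some i then Xs i else X) ->
  mutually_independent Xs.
Proof.
move=> H J B mB.
pose B' (o : option 'I_n) := if o is Some i then B i else setT.
have mB' o : measurable (B' o) by case: o => [i|] //=.
have := H (Some @: J)%SET B' mB'.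
rewrite big_imset/=; last by move=> i j _ _ [].
move=> <-; congr (P _); apply/seteqP; split => x Hx.
  by move=> o /= /imsetP[i iJ ->]; exact: Hx.
by move=> i iJ; apply: (Hx (Some i)); exact: imset_f.
Qed.

Theorem theorem2p6 (dT : measure_display) (T : measurableType dT)
  (R : realType) (P : probability T R) (d n : nat) (hd : (0 < d)%N)
  (hn : (0 < n)%N) (X : {RV P >-> d.-tuple R})
  (Xs : 'I_n -> {RV P >-> d.-tuple R})
  (hiid : iid (fun o : option 'I_n => if o is Some i then Xs i else X))
  (hX2 : square_integrable X) (hX0 : centered X)
  (Sigma : 'M[R]_d) (hSigma : Sigma = covmx X) (hinv : Sigma \in unitmx)
  (alpha : R) (halpha : 0 < alpha)
  (hmoment : forall V : 'M[R]_d,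
    let q := fun w => quadform V (standardized X w) in
    ('E_P[fun w => ((q w - expect P q) ^+ 4)%R] <=
      (alpha ^+ 2 * frob V ^+ 4)%:E)%E)
  (hn1 : 5 * effrank (Sigma ^+ 2) *
      (3 * effrank Sigma ^+ 2 +
        2 * effrank (Sigma ^+ 2) * effrank Sigma ^+ 2 / alpha) <= n%:R)
  (hn2 : 96 * (1 + Num.sqrt alpha) ^+ 2 *
      (3 * effrank Sigma ^+ 2 +
        2 * effrank (Sigma ^+ 2) * effrank Sigma ^+ 2 / alpha) <=
      alpha * n%:R)
  (delta : R) (hdelta0 : 0 < delta) (hdelta1 : delta < 1) :
  let frakR := alpha * effrank (Sigma ^+ 2) ^+ 2 +
    alpha ^+ 2 * effrank (Sigma ^+ 4) +
    5 * alpha ^+ 2 * effrank Sigma ^+ 2 / (2 * n%:R) *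
      (3 * effrank Sigma ^+ 2 +
        2 * effrank (Sigma ^+ 2) * effrank Sigma ^+ 2 / alpha) in
  let err := fun w => frob (sample_covmx Xs w - Sigma) ^+ 2 in
  ((1 - delta)%:E <=
    P [set w | (err w - expect P err >
      - (4 * opnorm Sigma ^+ 2 / n%:R *
         Num.max (2 * alpha * ln (5 / delta))
                 (Num.sqrt (2 * frakR * ln (5 / delta)))))%R])%E.
Proof.
subst Sigma; move: hiid => [/mutually_independent_some indepX sameL].
have sameX i B : measurable B -> distribution P (Xs i) B = distribution P X B.
  exact: (sameL (Some i) None).
cbv zeta; set S := covmx X in hinv hn1 hn2 *.
set frakR := (X in Num.sqrt (2 * X * ln _)).
set err := fun w : T => frob (sample_covmx Xs w - S) ^+ 2.
have symS : S^T = S by exact: covmx_sym.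
have op0 : 0 < opnorm S by exact: opnorm_gt0.
have kap0 : 0 < opnorm S ^+ 2 by rewrite exprn_gt0.
have N0 : 0 < n%:R :> R by rewrite ltr0n.
pose a := cov_coord S.
have ma := measurable_cov_coord S.
have a4 := intg_cov_coord4 hd hX2 hinv hmoment.
have a0 := Rintg_cov_coord hX2.
have errE w : err w = dotf (sample_mean Xs a w) (sample_mean Xs a w).
  suff E : vecf (sample_covmx Xs w - S) = sample_mean Xs a w.
    by rewrite /err sqr_frob_tr -dotf_vecf E.
  apply/funext => k; rewrite /vecf /sample_mean /a.
  set p := (enum_val k).1; set q := (enum_val k).2.
  transitivity (n%:R^-1 * \sum_(i < n) ((colv (Xs i w) *m (colv (Xs i w))^T) p q - S
    p q)).
    rewrite sumrB sumr_const card_ord mulrBr -[S p q *+ n]mulr_natl mulKf ?gt_eqF//.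
    by rewrite mxE [in LHS]mxE summxE [X in _ + X]mxE.
  by congr (_ * _); apply: eq_bigr => i _; rewrite /cov_coord /vecf !mxE.
have ierr : P.-integrable [set: T] (EFin \o err).
  rewrite (_ : err = fun w => dotf (sample_mean Xs a w) (sample_mean Xs a w)).
    exact: (intg_sqr_sample_mean indepX sameX ma a4).
  exact/funext.
set trQ := \sum_k second_moment X a k k.
have Eerr : expect P err = trQ / n%:R.
  rewrite expectE -(Rintg_sqr_sample_mean hn indepX sameX ma a4 a0).
  by apply: eq_Rintegral => w _; exact: errE.
pose L := ln (5 / delta).
have L0 : 0 < L by rewrite ln_gt0// ltr_pdivlMr// mul1r; lra.
set tau := (\tr S) ^+ 2; set T2 := \tr (S *m S); set T4 := \tr (S *m S *m (S *m S)).
have T20 : 0 < T2.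
  rewrite /T2 -{1}symS -sqr_frob_tr exprn_gt0//.
  exact: lt_le_trans op0 (opnorm_le_frob S).
have T40 : 0 <= T4 by rewrite /T4 -{1 2}symS -trmx_mul -sqr_frob_tr sqr_ge0.
set r := effrank S in hn1 hn2 frakR *; set r2 :=
  effrank (S ^+ 2) in hn1 hn2 frakR *.
set r4 := effrank (S ^+ 4) in frakR *.
have r2ge : T2 / opnorm S ^+ 2 <= r2 by exact: effrank_expmx2_ge.
have r4ge : T4 / opnorm S ^+ 4 <= r4 by exact: effrank_expmx4_ge.
(* The constant 15/2 is 5/2 times the 3 in the last bracket of [frakR]; the rest of that bracket
   contributes a nonnegative term. Here tau = (r |Sigma|)^2. *)
have F0 : alpha * T2 ^+ 2 + alpha ^+ 2 * T4 + 15 / 2 * alpha ^+ 2 * tau ^+ 2 / n%:R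
  <=
    frakR * (opnorm S ^+ 2) ^+ 2.
  set o := opnorm S in op0 kap0 r2ge r4ge *.
  have rE : tau = (r * o) ^+ 2 by rewrite /r /effrank divfK// gt_eqF.
  have r20 : 0 <= r2 by apply: le_trans r2ge; rewrite divr_ge0 ?sqr_ge0// ltW.
  rewrite ler_pdivrMr// in r2ge; rewrite ler_pdivrMr ?exprn_gt0// in r4ge.
  have A2 : alpha * T2 ^+ 2 <= alpha * (r2 * o ^+ 2) ^+ 2.
    rewrite ler_wpM2l ?(ltW halpha)// lerXn2r// nnegrE; first exact: ltW.
    by rewrite mulr_ge0// sqr_ge0.
  have A4 : alpha ^+ 2 * T4 <= alpha ^+ 2 * (r4 * o ^+ 4) by rewrite ler_wpM2l//
    sqr_ge0.
  have A0 : 0 <= 5 * alpha * r ^+ 4 * r2 / n%:R * o ^+ 4.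
    have h4 : 0 <= r ^+ 4 by rewrite (exprM r 2 2) sqr_ge0.
    rewrite mulr_ge0 ?(exprn_ge0 4 (ltW op0))// divr_ge0// mulr_ge0// mulr_ge0//.
    by rewrite mulr_ge0// ltW.
  rewrite (_ : frakR * _ = alpha * (r2 * o ^+ 2) ^+ 2 + alpha ^+ 2 * (r4 * o ^+ 4) +
    15 / 2 * alpha ^+ 2 * tau ^+ 2 / n%:R + 5 * alpha * r ^+ 4 * r2 / n%:R * o ^+
      4).
    by rewrite rE; lra.
  by rewrite rE /frakR; field; rewrite !gt_eqF.
have Fgt0 : 0 < frakR.
  rewrite -(pmulr_lgt0 _ (exprn_gt0 2 kap0)); apply: lt_le_trans F0.
  have h1 : 0 < alpha * T2 ^+ 2 by rewrite mulr_gt0// exprn_gt0.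
  have h2 : 0 <= alpha ^+ 2 * T4 by rewrite mulr_ge0// sqr_ge0.
  have h3 : 0 <= 15 / 2 * alpha ^+ 2 * tau ^+ 2 / n%:R.
    by rewrite divr_ge0// mulr_ge0 ?sqr_ge0// mulr_ge0 ?sqr_ge0.
  lra.
have [lam [lam0 lam_le lam_t]] := chernoff_choice N0 halpha kap0 Fgt0 L0.
set t := 4 * _ / _ * _ in lam_t *.
have mgf := mgf_sqr_sample_mean hn indepX sameX ma a4 a0
  (fun k l => kronf_sym k l symS) (qf_kronf_ge0 hd hX2) (qf_kronf_le hd hX2)
  halpha kap0 (Rintg_dot4_cov hd hX2 hinv hmoment) lam0 lam_le.
have fQle := frob_cov_second_moment_le hd hX2 hinv hmoment halpha.
set fQ := \sum_k \sum_l second_moment X _ k l ^+ 2 in mgf fQle *.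
rewrite sum_kronf_diag -/tau in mgf.
set c := lam ^+ 2 * _ / _ + _ in mgf.
(* The factor 8 comes from [chernoff_choice] and leaves room above the actual exponent [c]. *)
pose c8 := 8 * frakR * (opnorm S ^+ 2) ^+ 2 * lam ^+ 2 / n%:R ^+ 2.
have c80 : 0 <= c8.
  by rewrite divr_ge0 ?sqr_ge0// mulr_ge0 ?sqr_ge0// mulr_ge0 ?sqr_ge0//
    mulr_ge0 ?ltW.
have cc8 : c <= c8.
  rewrite (_ : c = (fQ + 6 * alpha ^+ 2 * tau ^+ 2 / n%:R) * (lam ^+ 2 / n%:R ^+
    2)); last first.
    by rewrite /c; field; rewrite gt_eqF.
  rewrite (_ : c8 = 8 * (frakR * (opnorm S ^+ 2) ^+ 2) * (lam ^+ 2 / n%:R ^+ 2));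
    last first.
    by rewrite /c8; field; rewrite gt_eqF.
  rewrite ler_wpM2r ?divr_ge0 ?sqr_ge0//.
  have h : 0 <= alpha ^+ 2 * tau ^+ 2 / n%:R by rewrite divr_ge0//
    mulr_ge0 ?sqr_ge0.
  have Fk : 0 < frakR * (opnorm S ^+ 2) ^+ 2 by rewrite mulr_gt0// exprn_gt0.
  move: fQle F0; rewrite -/T2 -/T4; lra.
(* Both summands of the last factor are at most exp c8, so the product is at most 2 exp (- L) = 2
   delta / 5. *)
have exp_le : expR (- (lam * t)) * (expR c + 1) <= delta.
  apply: (@le_trans _ _ (expR (- L - c8) * (expR c8 + expR c8))).
    rewrite ler_pM ?expR_ge0 ?addr_ge0 ?expR_ge0//.
      by rewrite ler_expR -opprD lerN2.
    by rewrite lerD ?ler_expR// -[leLHS]expR0 ler_expR.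
  rewrite mulrDr -expRD subrK expRN lnK ?posrE ?divr_gt0// invf_div; lra.
have merr : measurable_fun [set: T] err by exact: intg_measurable ierr.
set A := [set w | _].
have mA : measurable A.
  rewrite (_ : A = [set: T] `&` (fun w => err w - expect P err) @^-1` `]- t,
    +oo[%classic).
    by apply: measurable_funB => //; exact: measurable_itv.
  by rewrite setTI; apply/seteqP; split => w /=; rewrite in_itv/= andbT.
suff PAc : (P (~` A) <= delta%:E)%E.
  have -> : P A = (1 - P (~` A))%E.
    by rewrite -probability_setC ?setCK//; exact: measurableC.
  by rewrite EFinB leeD2l// leeN2.
have mE : measurable_fun [set: T] (fun w => (expR (- lam * dotf (sample_mean Xs a w)
  (sample_mean Xs a w)))%:E).
  apply/measurable_EFinP; apply: measurableT_comp => //;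
    apply: measurable_funM => //.
  by rewrite (_ : (fun w => dotf _ _) = err)//; apply/funext => w; rewrite errE.
have E0 w : [set: T] w -> (0 <= (expR (- lam * dotf (sample_mean Xs a w)
  (sample_mean Xs a w)))%:E)%E.
  by rewrite lee_fin expR_ge0.
have mAc : measurable (~` A) by exact: measurableC.
have -> : P (~` A) = (\int[P]_w (\1_(~` A) w)%:E)%E by rewrite integral_indic//
  setIT.
(* Markov's inequality for exp (lam (trQ / n - t - err)), which is at least 1 outside [A]. *)
apply: (@le_trans _ _ (\int[P]_w ((expR (lam * (trQ / n%:R - t)))%:E *
    (expR (- lam * dotf (sample_mean Xs a w) (sample_mean Xs a w)))%:E))%E).
  apply: ge0_le_integral => //.
  - by apply/measurable_EFinP; apply: measurable_indic; exact: measurableC.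
  - exact: emeasurable_funM.
  move=> w _; rewrite -EFinM lee_fin -expRD -errE indicE.
  case: (boolP (w \in ~` A)) => [|_]; last by rewrite expR_ge0.
  rewrite inE /A/= => /negP; rewrite -leNgt Eerr => h.
  rewrite -[leLHS]expR0 ler_expR (_ : _ + _ = lam * (trQ / n%:R - t - err w));
    last by ring.
  by rewrite mulr_ge0//; move: h; rewrite -/(err w); lra.
rewrite ge0_integralZl_EFin ?expR_ge0//.
apply: (@le_trans _ _ ((expR (lam * (trQ / n%:R - t)))%:E * (expR (- lam * (trQ /
  n%:R)) * (expR c + 1))%:E)%E).
  by rewrite lee_wpmul2l ?lee_fin ?expR_ge0.
rewrite -EFinM lee_fin mulrA -expRD (_ : _ + _ = - (lam * t)) //; last by ring.
Qed.
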